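(* Let $a>1$ be a natural number and let $X\subset(\mathbb{R}/\mathbb{Z})^{\mathbb{N}}$ be a nonempty closed subset such that $\sigma(X)\subset X$ and $T_a(X)\subset X$, where $\sigma((x_n)_{n\in\mathbb{N}})=(x_{n+1})_{n\in\mathbb{N}}$ and $T_a((x_n)_{n\in\mathbb{N}})=(ax_n)_{n\in\mathbb{N}}$. Let $d$ be the metric $d((x_n)_n,(y_n)_n)=\sum_{n=1}^\infty 2^{-n}\rho(x_n,y_n)$, where $\rho(u,v)=\min_{k\in\mathbb{Z}}|u-v-k|$ on $\mathbb{R}/\mathbb{Z}$. Then the mean Hausdorff dimension $\mathrm{mdim}_{\mathrm{H}}(X,\sigma,d)$ and the metric mean dimension $\mathrm{mdim}_{\mathrm{M}}(X,\sigma,d)$ both exist (i.e. the upper and lower versions coincide) and \[ \mathrm{mdim}_{\mathrm{H}}(X,\sigma,d)=\mathrm{mdim}_{\mathrm{M}}(X,\sigma,d)=\frac{h_{\mathrm{top}}(X,\sigma,T_a)}{\log a}, \] where $h_{\mathrm{top}}(X,\sigma,T_a)$ is the topological entropy of the $\mathbb{N}^2$-action on $X$ generated by the commuting maps $\sigma$ and $T_a$.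
   Context: $\mathbb{N}=\{1,2,3,\dots\}$; $\log$ is the natural logarithm. For a compact metric space $(X,d)$ and $\varepsilon>0$, the covering number $\#(X,d,\varepsilon)$ is the minimum $n$ such that $X$ has an open cover $\{U_1,\dots,U_n\}$ with $\mathrm{Diam}\,U_i<\varepsilon$ for all $i$. Set $\dim_{\mathrm{M}}(X,d,\varepsilon)=\log\#(X,d,\varepsilon)/\log(1/\varepsilon)$. For $s\ge 0$ set $\mathcal{H}^s_\varepsilon(X,d)=\inf\{\sum_{i=1}^\infty(\mathrm{Diam}\,E_i)^s : X=\bigcup_{i=1}^\infty E_i,\ \mathrm{Diam}\,E_i<\varepsilon\ \forall i\}$, with conventions $0^0=1$ and $(\mathrm{Diam}\,\emptyset)^s=0$ for all $s\ge0$. The $\varepsilon$-scale Hausdorff dimension $\dim_{\mathrm{H}}(X,d,\varepsilon)$ is the supremum of $s\ge0$ with $\mathcal{H}^s_\varepsilon(X,d)\ge1$. For a continuous map $T:X\to X$ and $N\ge1$ let $d_N(x,y)=\max_{0\le n<N}d(T^nx,T^ny)$. The upper and lower metric mean dimensions of $(X,T,d)$ are the $\limsup$ and $\liminf$ as $\varepsilon\to0$ of $\lim_{N\to\infty}\dim_{\mathrm{M}}(X,d_N,\varepsilon)/N$; if equal, the common value is $\mathrm{mdim}_{\mathrm{M}}(X,T,d)$. The upper and lower mean Hausdorff dimensions are $\lim_{\varepsilon\to0}\limsup_{N\to\infty}\dim_{\mathrm{H}}(X,d_N,\varepsilon)/N$ and $\lim_{\varepsilon\to0}\liminf_{N\to\infty}\dim_{\mathrm{H}}(X,d_N,\varepsilon)/N$;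 if equal, the common value is $\mathrm{mdim}_{\mathrm{H}}(X,T,d)$. For commuting continuous maps $S,T:X\to X$ of a compact metric space, let $d^{S,T}_{[0,N)^2}(x,y)=\max_{0\le m<N,\,0\le n<N}d(S^mT^nx,S^mT^ny)$ and $h_{\mathrm{top}}(X,S,T)=\lim_{\varepsilon\to0}\lim_{N\to\infty}\frac{1}{N^2}\log\#(X,d^{S,T}_{[0,N)^2},\varepsilon)$. *)

(* Defs.v *)
From HB Require Import structures.
From mathcomp Require Import all_boot all_order all_algebra.
From mathcomp Require Import generic_quotient ring_quotient.
From mathcomp Require Import all_classical all_reals all_analysis.
From mathcomp Require Import ring lra.

Set Implicit Arguments.
Unset Strict Implicit.
Unset Printing Implicit Defensive.

Import Order.TTheory GRing.Theory Num.Theory.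
Import numFieldNormedType.Exports.

Local Open Scope classical_set_scope.
Local Open Scope ring_scope.
Local Open Scope quotient_scope.

Section circle.
Variable R : realType.

(* R/Z: the quotient group of R by the subgroup [Num.int], with the quotient
   topology. *)
Definition integers : zmodClosed R := (@Num.int_num_subdef R : {pred R}).

Lemma integersE (x : R) : (x \in integers) = (x \is a Num.int).
Proof. by []. Qed.

Definition circle := Quotient.quot integers.

HB.instance Definition _ := GRing.Zmodule.on circle.
HB.instance Definition _ := EqQuotient.on circle.

(* The library's [quotient_topology] does not share the choice structure of the
   quotient group, so the same topology is built directly on [circle]. *)
Definition circle_open (U : set circle) : Prop := open (\pi_circle @^-1` U).

Lemma circle_openT : circle_open setT.
Proof. by rewrite /circle_open preimage_setT; exact: openT. Qed.

Lemma circle_openI (U V : set circle) :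
  circle_open U -> circle_open V -> circle_open (U `&` V).
Proof. exact: openI. Qed.

Lemma circle_open_bigcup (I : Type) (U : I -> set circle) :
  (forall i, circle_open (U i)) -> circle_open (\bigcup_i U i).
Proof. by move=> oU; apply: bigcup_open => i _; exact: oU. Qed.

HB.instance Definition _ := isOpenTopological.Build circle
  circle_openT circle_openI circle_open_bigcup.

(* min_k |u - v - k|; [circle_dist_pi] and [circle_dist_attained] show that the
   choice of representatives is immaterial and that the infimum is a minimum. *)
Definition circle_dist (u v : circle) : R :=
  inf [set `|repr u - repr v - k%:~R| | k in [set: int]].

Lemma dist_int_min (t : R) :
  exists k : int, forall j : int, `|t - k%:~R| <= `|t - j%:~R|.
Proof.
exists (Num.floor (t + 2^-1)) => j.
have := floor_itv (t + 2^-1); set k := Num.floor _.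
rewrite intrD => /andP[kt tk].
have tk2 : `|t - k%:~R| <= 2^-1 by rewrite ler_norml; apply/andP; split; lra.
have [->//|] := eqVneq j k; rewrite neq_lt => /orP[jk|kj]; apply: le_trans tk2 _.
  have : j%:~R + 1 <= k%:~R :> R by rewrite -(intrD R j 1) ler_int lezD1.
  by move=> h; apply: le_trans (ler_norm _); lra.
have : k%:~R + 1 <= j%:~R :> R by rewrite -(intrD R k 1) ler_int lezD1.
by move=> h; rewrite -normrN; apply: le_trans (ler_norm _); lra.
Qed.

Lemma circle_dist_attained (u v : circle) :
  exists2 k : int, circle_dist u v = `|repr u - repr v - k%:~R|
    & forall j : int, circle_dist u v <= `|repr u - repr v - j%:~R|.
Proof.
have [k kmin] := dist_int_min (repr u - repr v).
have E : circle_dist u v = `|repr u - repr v - k%:~R|.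
  apply/eqP; rewrite eq_le; apply/andP; split.
    apply: ge_inf; last by exists k.
    by exists 0 => _ [j _ <-].
  apply: lb_le_inf; first by exists `|repr u - repr v - k%:~R|, k.
  by move=> _ [j _ <-].
by exists k => // j; rewrite E.
Qed.

Lemma circle_dist_pi (x y : R) :
  circle_dist (\pi_circle x) (\pi_circle y) =
  inf [set `|x - y - k%:~R| | k in [set: int]].
Proof.
have rep (z : R) : exists m : int, repr (\pi_circle z) = z + m%:~R.
  have : repr (\pi_circle z) - z \in integers.
    by rewrite Quotient.idealrBE reprK.
  rewrite integersE => /intrP[m mE]; exists m.
  by rewrite -mE addrCA subrr addr0.
have [m mE] := rep x; have [n nE] := rep y.
rewrite /circle_dist mE nE; congr inf; apply/seteqP; split => _ [k _ <-].
  exists (k - m + n) => //; congr `|_|; rewrite !(rmorphB, rmorphD)/=; ring.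
exists (k + m - n) => //; congr `|_|; rewrite !(rmorphB, rmorphD)/=; ring.
Qed.

(* (R/Z)^N with the product topology; [x n] is the coordinate of index n + 1. *)
Definition circle_seq := {ptws nat -> circle}.

HB.instance Definition _ := Topological.on circle_seq.

Definition seq_shift (x : circle_seq) : circle_seq := fun n => x n.+1.

Definition seq_mul (a : nat) (x : circle_seq) : circle_seq := fun n => x n *+ a.

Definition seq_dist (x y : circle_seq) : R :=
  limn (series (fun n => 2 ^- n.+1 * circle_dist (x n) (y n))).

End circle.

(* A metric space is given by a subset X of a type together with a function d
   that is used only on X; a self-map of X is a function leaving X invariant. *)
Section metric_invariants.
Local Open Scope ereal_scope.
Variables (R : realType) (T : Type).
Implicit Types (X E : set T) (d : T -> T -> R) (f g : T -> T) (e s : R).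

Definition relatively_open X d (U : set T) : Prop :=
  U `<=` X /\
  forall x, U x -> exists2 r : R, (0 < r)%R & forall y, X y -> (d x y < r)%R -> U y.

Definition diam d E : \bar R :=
  maxe 0 (ereal_sup [set (d p.1 p.2)%:E | p in E `*` E]).

Definition covering_number X d e : \bar R :=
  ereal_inf [set n%:R%:E | n in [set n : nat | exists U : 'I_n -> set T,
    [/\ forall i, relatively_open X d (U i),
        forall i, diam d (U i) < e%:E
      & X = \bigcup_i U i]]].

Definition dimM X d e : \bar R :=
  lne (covering_number X d e) / (ln (1 / e))%:E.

(* [poweR 0 0 = 1], so only the empty set needs a special case. *)
Definition diam_pow d s E : \bar R :=
  if `[< E = set0 >] then 0 else poweR (diam d E) s.

Definition hausdorff X d e s : \bar R :=
  ereal_inf [set \sum_(0 <= i <oo) diam_pow d s (E i) | E in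
    [set E : nat -> set T |
      X = \bigcup_i E i /\ forall i, diam d (E i) < e%:E]].

Definition dimH X d e : \bar R :=
  ereal_sup [set s%:E | s in [set s : R | (0 <= s)%R /\ 1 <= hausdorff X d e s]].

(* The leading 0 is neutral, distances being nonnegative. *)
Definition dyn_dist f d (N : nat) (x y : T) : R :=
  \big[Num.max/0%R]_(n < N) d (iter n f x) (iter n f y).

Definition dyn_dist2 f g d (N : nat) (x y : T) : R :=
  \big[Num.max/0%R]_(m < N) \big[Num.max/0%R]_(n < N)
    d (iter m f (iter n g x)) (iter m f (iter n g y)).

(* The limit over N exists by subadditivity of the logarithm of the covering
   number. *)
Definition mdimM_scale X f d e : \bar R :=
  limn (fun N : nat => dimM X (dyn_dist f d N) e / N%:R%:E).

Definition upper_mdimM X f d : \bar R := limf_esup (mdimM_scale X f d) 0^'+.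
Definition lower_mdimM X f d : \bar R := limf_einf (mdimM_scale X f d) 0^'+.

(* The limits over e exist by monotonicity in e. *)
Definition upper_mdimH X f d : \bar R :=
  lim (limn_esup (fun N : nat => dimH X (dyn_dist f d N) e / N%:R%:E)
       @[e --> (0 : R)^'+]).
Definition lower_mdimH X f d : \bar R :=
  lim (limn_einf (fun N : nat => dimH X (dyn_dist f d N) e / N%:R%:E)
       @[e --> (0 : R)^'+]).

Definition htop2 X f g d : \bar R :=
  lim (limn (fun N : nat =>
         lne (covering_number X (dyn_dist2 f g d N) e) / (N ^ 2)%:R%:E)
       @[e --> (0 : R)^'+]).

End metric_invariants.

(* Main.v *)
Require Import Defs.
From HB Require Import structures.
From mathcomp Require Import all_boot all_order all_algebra.
From mathcomp Require Import generic_quotient ring_quotient.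
From mathcomp Require Import all_classical all_reals all_analysis.
From mathcomp Require Import ring lra.

(** Let d_(N,M) be the maximum of d(sigma^i T_a^j x, sigma^i T_a^j y) over i < N and
    j < M, and A(N,M) the least size of an open cover of X by sets of
    d_(N,M)-diameter less than c.  The logarithm of A is subadditive in each variable,
    so log A(N,N) / N^2 tends to h_c, the infimum of log A(p,q) / (pq).

    Upper bound: T_a multiplies small distances of R/Z by exactly a.  Closeness at the
    fixed scale c along about log(1/e) / log a iterates of T_a and N + L iterates of
    sigma therefore gives d_(N,1)-closeness at scale e, and the metric mean dimension
    is at most h_c / log a as soon as c is small.

    Lower bound (Furstenberg): let sets E_i cover X, with d_(N,1)-diameters whose s-th
    powers add up to less than 1.  Then E_i has d_(N,k_i)-diameter less than c for some
    k_i of order log(1/diam E_i) / log a, and the numbers a^(-k_i s') add up to less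
    than 1 for s' slightly larger than s.  Refining E_i by the pullback under T_a^(k_i)
    of an optimal cover yields A(N,M) <= sum_i A(N, M - k_i), hence
    A(N,M) = O(a^(s' M)) and N h_c <= s' log a.

    Since the mean Hausdorff dimension never exceeds the metric mean dimension, all
    quantities are h_c / log a, for every small c; thus h_c is eventually constant. *)

Set Implicit Arguments.
Unset Strict Implicit.
Unset Printing Implicit Defensive.

Import Order.TTheory GRing.Theory Num.Theory.
Import numFieldNormedType.Exports.

Local Open Scope classical_set_scope.
Local Open Scope ring_scope.

(** * Pseudometrics and covers *)

Section pseudometric_balls.
Variables (R : realType) (T : Type).
Implicit Types (X E : set T) (d D : T -> T -> R).

Record is_pseudometric d : Prop := IsPseudometric {
  pseudo_refl : forall x, d x x = 0;
  pseudo_sym : forall x y, d x y = d y x;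
  pseudo_tri : forall x y z, d x z <= d x y + d y z }.

Lemma pseudo_ge0 d : is_pseudometric d -> forall x y, 0 <= d x y.
Proof.
move=> hd x y; have := pseudo_tri hd x y x.
by rewrite (pseudo_refl hd) (pseudo_sym hd y x); lra.
Qed.

Lemma diam_ge0 D E : (0 <= diam D E)%E.
Proof. by rewrite /diam le_max lexx. Qed.

Lemma diam_ub D E x y : E x -> E y -> ((D x y)%:E <= diam D E)%E.
Proof.
move=> Ex Ey; rewrite /diam le_max; apply/orP; right.
by apply: ereal_sup_ubound; exists (x, y).
Qed.

Lemma diam_le D E (b : R) : 0 <= b ->
  (forall x y, E x -> E y -> D x y <= b) -> (diam D E <= b%:E)%E.
Proof.
move=> b0 h; rewrite /diam ge_max lee_fin b0 /=.
by apply: ge_ereal_sup => _ [[x y] [/= Ex Ey] <-]; rewrite lee_fin h.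
Qed.

Lemma diam_lt D E (b c : R) : 0 <= b -> b < c ->
  (forall x y, E x -> E y -> D x y <= b) -> (diam D E < c%:E)%E.
Proof. by move=> b0 bc h; apply: le_lt_trans (diam_le b0 h) _; rewrite lte_fin. Qed.

Lemma diam_ltW D E (c : R) : (diam D E < c%:E)%E ->
  exists b : R, [/\ 0 <= b, b < c, diam D E = b%:E &
    forall x y, E x -> E y -> D x y <= b].
Proof.
move=> h; have fin : diam D E \is a fin_num.
  by rewrite ge0_fin_numE ?diam_ge0//; apply: lt_trans h _; rewrite ltry.
exists (fine (diam D E)); split.
- by rewrite fine_ge0 ?diam_ge0.
- by rewrite -lte_fin fineK.
- by rewrite fineK.
- by move=> x y Ex Ey; rewrite -lee_fin fineK//; apply: diam_ub.
Qed.

Lemma rel_openI X d U V :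
  relatively_open X d U -> relatively_open X d V -> relatively_open X d (U `&` V).
Proof.
move=> [UX oU] [VX oV]; split=> [x [/UX//]|x [Ux Vx]].
have [r r0 hr] := oU x Ux; have [s s0 hs] := oV x Vx.
exists (Num.min r s); first by rewrite lt_min r0.
by move=> y Xy; rewrite lt_min => /andP[yr ys]; split; [exact: hr|exact: hs].
Qed.

Lemma rel_open_preimage X d U (F : T -> T) (L : R) : 0 < L ->
  (forall x, X x -> X (F x)) -> (forall x y, d (F x) (F y) <= L * d x y) ->
  relatively_open X d U -> relatively_open X d (X `&` F @^-1` U).
Proof.
move=> L0 FX FL [UX oU]; split=> [x []//|x [Xx /= Ux]].
have [r r0 hr] := oU _ Ux; exists (r / L); first by rewrite divr_gt0.
move=> y Xy; rewrite ltr_pdivlMr// mulrC => xy; split => //.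
by apply: hr; [exact: FX|exact: le_lt_trans xy].
Qed.

Lemma rel_open_lipschitz X d D (L : R) U : 0 < L ->
  (forall x y, D x y <= L * d x y) ->
  relatively_open X D U -> relatively_open X d U.
Proof.
move=> L0 DL [UX oU]; split=> // x Ux.
have [r r0 hr] := oU _ Ux; exists (r / L); first by rewrite divr_gt0.
move=> y Xy; rewrite ltr_pdivlMr// mulrC => xy.
by apply: hr => //; apply: le_lt_trans xy.
Qed.

(** Hausdorff sums allow arbitrary covering sets. Thickening by a small radius makes them open, at
    the cost of [2 * r] in the diameter bound. *)
Definition thickening X d E (r : R) : set T :=
  [set x | X x /\ exists2 y, E y & d y x < r].

Lemma thickening_open X d E r : is_pseudometric d ->
  relatively_open X d (thickening X d E r).
Proof.
move=> hd; split=> [x []//|x [Xx [y Ey yx]]].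
exists (r - d y x); first by rewrite subr_gt0.
move=> z Xz xz; split=> //; exists y => //.
by apply: le_lt_trans (pseudo_tri hd y x z) _; lra.
Qed.

Lemma sub_thickening X d E r : is_pseudometric d -> 0 < r ->
  E `<=` X -> E `<=` thickening X d E r.
Proof. by move=> hd r0 EX x Ex; split; [exact: EX|exists x; rewrite ?(pseudo_refl hd)]. Qed.

Lemma thickening_diam X d E r (b : R) : is_pseudometric d ->
  (forall x y, E x -> E y -> d x y <= b) ->
  forall x y, thickening X d E r x -> thickening X d E r y -> d x y <= b + 2 * r.
Proof.
move=> hd h x y [_ [x' Ex x'x]] [_ [y' Ey y'y]].
have := h _ _ Ex Ey; have := pseudo_tri hd x x' y; have := pseudo_tri hd x' y' y.
by rewrite (pseudo_sym hd x x'); lra.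
Qed.

(** Covers are indexed by [T] itself: balls around points form such a cover directly, and any other
    cover is reindexed by choosing for each point a member containing it. *)
Definition relatively_compact X d : Prop :=
  forall U : T -> set T, (forall t, relatively_open X d (U t)) ->
  X `<=` \bigcup_t U t -> exists n (v : 'I_n -> T), X `<=` \bigcup_i U (v i).

Lemma relatively_compact_nat X d (U : nat -> set T) : X !=set0 ->
  relatively_compact X d -> (forall t, relatively_open X d (U t)) ->
  X `<=` \bigcup_t U t -> exists n, X `<=` \bigcup_(i < n) U i.
Proof.
move=> [x0 Xx0] Xc oU XU.
have /choice[k hk] : forall x, exists k, X x -> U k x.
  move=> x; have [Xx|nXx] := pselect (X x); last by exists 0%N.
  by have [k _ Uk] := XU x Xx; exists k.
have [|x Xx|n [v hv]] := Xc (fun t => U (k t)); first by move=> t; exact: oU.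
  by exists x => //; exact: hk.
exists (\max_(i < n) (k (v i)).+1)%N => x /hv[i _ Ui].
by exists (k (v i)) => //=; rewrite (leq_bigmax (F := fun i => (k (v i)).+1) i).
Qed.

End pseudometric_balls.

(** * Open covers by sets of small diameter and their least size *)

Section covers.
Variables (R : realType) (T : Type) (X : set T) (d : T -> T -> R).
Implicit Types (D : T -> T -> R) (c : R).

(** Openness always refers to the fixed [d] and smallness to the varying [D], so that sets small for
    different dynamical metrics can be intersected. *)
Definition covers_by (I : Type) D c (U : I -> set T) : Prop :=
  [/\ forall i, relatively_open X d (U i), forall i, (diam D (U i) < c%:E)%E
    & X `<=` \bigcup_i U i].

Definition coverable D c n : Prop := exists U : 'I_n -> set T, covers_by D c U.

(** The covering number as a natural number; [xget] falls back on its default 0 only if there is no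
    finite cover. *)
Definition mincover D c : nat :=
  xget 0%N [set n | coverable D c n /\ forall m, coverable D c m -> (n <= m)%N].

Lemma mincoverP D c : (exists n, coverable D c n) ->
  coverable D c (mincover D c) /\
  forall m, coverable D c m -> (mincover D c <= m)%N.
Proof.
move=> [n hn]; have exP : exists n, `[< coverable D c n >] by exists n; apply/asboolP.
rewrite /mincover; case: xgetP => // /(_ (ex_minn exP)) []; case: ex_minnP => m /asboolP hm h.
by split=> // k hk; apply: h; apply/asboolP.
Qed.

Lemma covers_by_fin (I : finType) D c (U : I -> set T) :
  covers_by D c U -> coverable D c #|I|.
Proof.
move=> [oU dU XU]; exists (fun i => U (enum_val i)); split => //.
by move=> x /XU[i _ Ui]; exists (enum_rank i); rewrite // enum_rankK.
Qed.

(** The two Lipschitz bounds make [d] and [D] define the same open sets, so the two notions of open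
    cover agree. *)
Lemma covering_numberE D c : 0 < c -> (exists n, coverable D c n) ->
  (exists2 L : R, 0 < L & forall x y, d x y <= L * D x y) ->
  (exists2 L : R, 0 < L & forall x y, D x y <= L * d x y) ->
  covering_number X D c = (mincover D c)%:R%:E.
Proof.
move=> c0 ex [L L0 dD] [L' L'0 Dd]; have [h1 h2] := mincoverP ex.
rewrite /covering_number; apply/eqP; rewrite eq_le; apply/andP; split.
  apply: ereal_inf_lbound; exists (mincover D c) => //=.
  have [U [oU dU XU]] := h1; exists U; split=> // [i|].
    exact: rel_open_lipschitz L0 dD (oU i).
  by apply/seteqP; split=> // x [i _ Ui]; apply: (oU i).1.
apply: le_ereal_inf_tmp => _ [n [U [oU dU XU]] <-].
rewrite lee_fin ler_nat; apply: h2; exists U; split=> // [i|].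
  exact: rel_open_lipschitz L'0 Dd (oU i).
by rewrite -XU.
Qed.

Lemma mincover_gt0 D c : X !=set0 -> (exists n, coverable D c n) ->
  (0 < mincover D c)%N.
Proof.
move=> [x Xx] /mincoverP[[U [_ _ XU]] _].
by have [i _ _] := XU _ Xx; exact: leq_ltn_trans (leq0n i) (ltn_ord i).
Qed.

Lemma mincover_mono D1 D2 c1 c2 :
  (exists n, coverable D1 c1 n) ->
  (forall U, (diam D1 U < c1%:E)%E -> U `<=` X -> (diam D2 U < c2%:E)%E) ->
  (mincover D2 c2 <= mincover D1 c1)%N.
Proof.
move=> /mincoverP[[U [oU dU XU]] _] h.
have C : coverable D2 c2 (mincover D1 c1).
  by exists U; split=> // i; apply: h (dU i) (oU i).1.
by apply: (mincoverP _).2 => //; exists (mincover D1 c1).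
Qed.

Lemma coverable_lipschitz D c (L : R) : is_pseudometric d ->
  relatively_compact X d -> 0 < c -> 0 < L ->
  (forall x y, D x y <= L * d x y) -> exists n, coverable D c n.
Proof.
(* A [d]-ball of radius [r] has [D]-diameter at most [2 * L * r], which is [c / 2]. *)
move=> hd Xc c0 L0 DL; set r := c / L / 4.
have r0 : 0 < r by rewrite !divr_gt0.
have [|x Xx|n [v hv]] := Xc (fun t => thickening X d [set t] r).
- by move=> t; exact: thickening_open.
- exists x => //; split=> //; exists x; rewrite //= pseudo_refl//.
exists n, (fun i => thickening X d [set v i] r); split => // i.
  exact: thickening_open.
apply: (@diam_lt _ _ _ _ (L * (2 * r))); first by apply: mulr_ge0; [exact: ltW|rewrite mulr_ge0 ?ltW].
  by rewrite /r [ltLHS](_ : _ = c / 2); [lra|field; rewrite gt_eqF].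
move=> x y hx hy; apply: (le_trans (DL _ _)).
apply: ler_wpM2l; first exact: ltW.
rewrite -[leRHS]add0r; apply: (thickening_diam hd _ hx hy).
by move=> ? ? -> ->; rewrite (pseudo_refl hd).
Qed.

(* Refines each member U_i of a finite cover by pulling back along F_i an optimal
   cover for D2_i; with different F_i this yields renewal-type inequalities. *)
Lemma mincover_split n (U : 'I_n -> set T) (D1 D2 : 'I_n -> T -> T -> R)
    (F : 'I_n -> T -> T) (L : 'I_n -> R) D c :
  (forall i, relatively_open X d (U i)) -> X `<=` \bigcup_i U i ->
  (forall i, (diam (D1 i) (U i) < c%:E)%E) ->
  (forall i, exists m, coverable (D2 i) c m) ->
  (forall i x, X x -> X (F i x)) ->
  (forall i, 0 < L i) -> (forall i x y, d (F i x) (F i y) <= L i * d x y) ->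
  (forall i x y, D x y <= Num.max (D1 i x y) (D2 i (F i x) (F i y))) ->
  (mincover D c <= \sum_i mincover (D2 i) c)%N.
Proof.
move=> oU XU dU cov FX L0 FL hD.
have hV i := (mincoverP (cov i)).1.
pose V i := projT1 (cid (hV i)).
have VP i : covers_by (D2 i) c (V i) by exact: projT2 (cid (hV i)).
pose I := {i : 'I_n & 'I_(mincover (D2 i) c)}.
pose W (j : I) := U (tag j) `&` (X `&` F (tag j) @^-1` V _ (tagged j)).
have WP : covers_by D c W.
  split=> [[i j]|[i j]|x Xx] /=.
  - apply: rel_openI (oU i) _; apply: rel_open_preimage (L0 i) (FX i) (FL i) _.
    by have [] := VP i.
  - have [b1 [b10 b1c _ h1]] := diam_ltW (dU i).
    have [_ /(_ j)/diam_ltW[b2 [b20 b2c _ h2]] _] := VP i.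
    apply: (@diam_lt _ _ _ _ (Num.max b1 b2)); first by rewrite le_max b10.
      by rewrite gt_max b1c.
    move=> x y [/= Ux [_ Vx]] [/= Uy [_ Vy]]; apply: le_trans (hD i x y) _.
    by rewrite ge_max !le_max h1//= h2// orbT.
  - have [i _ Ui] := XU x Xx; have [_ _ /(_ _ (FX i _ Xx))[j _ Vj]] := VP i.
    by exists (Tagged (fun i => 'I_(mincover (D2 i) c)) j).
have C := covers_by_fin WP.
have [_ /(_ _ C)] := mincoverP (ex_intro _ _ C).
by rewrite card_tagged sumnE big_map big_enum/=; under eq_bigr do rewrite card_ord.
Qed.

End covers.

(** * Functions subadditive in two variables *)

Section biadditive.
Variable R : realType.
Implicit Types (u : nat -> nat -> R).

Record bisubadditive u : Prop := BiSubadditive {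
  bisub_ge0 : forall N M, 0 <= u N M;
  bisub_monol : forall N N' M, (N <= N')%N -> u N M <= u N' M;
  bisub_monor : forall N M M', (M <= M')%N -> u N M <= u N M';
  bisub_addl : forall N N' M, u (N + N')%N M <= u N M + u N' M;
  bisub_addr : forall N M M', u N (M + M')%N <= u N M + u N M' }.

(** An N x M rectangle fits into one tiled by floor(N/p) + 1 times floor(M/q) + 1 copies of the p x
    q rectangle. *)
Lemma bisub_bound u : bisubadditive u -> forall p q N M, (0 < p)%N -> (0 < q)%N ->
  u N M <= (N%:R / p%:R + 1) * (M%:R / q%:R + 1) * u p q.
Proof.
move=> hu p q N M p0 q0.
have mull k P Q : u (k.+1 * P)%N Q <= k.+1%:R * u P Q.
  elim: k => [|k IH]; first by rewrite mul1n mul1r.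
  rewrite mulSn; apply: le_trans (bisub_addl hu _ _ _) _.
  by rewrite -(natr1 k.+1) mulrDl mul1r addrC lerD2r.
have mulr k P Q : u P (k.+1 * Q)%N <= k.+1%:R * u P Q.
  elim: k => [|k IH]; first by rewrite mul1n mul1r.
  rewrite mulSn; apply: le_trans (bisub_addr hu _ _ _) _.
  by rewrite -(natr1 k.+1) mulrDl mul1r addrC lerD2r.
have cl P K : (0 < P)%N -> (K <= (K %/ P).+1 * P)%N /\
    ((K %/ P).+1%:R <= K%:R / P%:R + 1 :> R).
  move=> P0; split; first by rewrite ltnW// -ltn_divLR.
  rewrite -natr1 lerD2r ler_pdivlMr ?ltr0n// -natrM ler_nat.
  exact: leq_trunc_div.
have [h1 h2] := cl _ N p0; have [h3 h4] := cl _ M q0.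
apply: le_trans (bisub_monol hu _ h1) _; apply: le_trans (bisub_monor hu _ h3) _.
apply: le_trans (mull _ _ _) _; rewrite -mulrA.
apply: ler_pM => //; first exact: bisub_ge0.
apply: le_trans (mulr _ _ _) _; apply: ler_wpM2r => //; exact: bisub_ge0.
Qed.

(** The Fekete constant of [u], an infimum over rectangles; the successors exclude empty sides. *)
Definition density u : R :=
  inf [set u p.1.+1 p.2.+1 / (p.1.+1 * p.2.+1)%:R | p in [set: nat * nat]].

Lemma density_has_inf u : bisubadditive u ->
  has_inf [set u p.1.+1 p.2.+1 / (p.1.+1 * p.2.+1)%:R | p in [set: nat * nat]].
Proof.
move=> hu; split; first by eexists; exists (0, 0)%N.
by exists 0 => _ [p _ <-]; rewrite divr_ge0 ?(bisub_ge0 hu).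
Qed.

Lemma density_ge0 u : bisubadditive u -> 0 <= density u.
Proof.
move=> hu; apply: lb_le_inf; first exact: (density_has_inf hu).1.
by move=> _ [p _ <-]; rewrite divr_ge0 ?(bisub_ge0 hu).
Qed.

Lemma density_le u N M : bisubadditive u -> (0 < N)%N -> (0 < M)%N ->
  density u * (N%:R * M%:R) <= u N M.
Proof.
case: N M => [//|N] [//|M] hu _ _; rewrite -ler_pdivlMr ?mulr_gt0 ?ltr0n// -natrM.
by apply: ge_inf; [exact: (density_has_inf hu).2|exists (N, M)].
Qed.

Lemma density_approx u (e : R) : bisubadditive u -> 0 < e ->
  exists p q, [/\ (0 < p)%N, (0 < q)%N & u p q < (density u + e) * (p%:R * q%:R)].
Proof.
move=> hu e0; have [_ [[p q] _ <-]] := inf_adherent e0 (density_has_inf hu).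
rewrite -/(density u) /= ltr_pdivrMr ?ltr0n// natrM => h.
by exists p.+1, q.+1.
Qed.

(** Fekete's lemma in two variables. The infimum bounds every quotient from below; tiling by a
    nearly optimal p x q rectangle bounds it from above, up to boundary terms of order 1/N. *)
Lemma density_cvg u : bisubadditive u ->
  (fun N : nat => u N N / (N ^ 2)%:R) @ \oo --> density u.
Proof.
move=> hu; apply/cvgrPdist_le => e e0.
have e20 : 0 < e / 2 by lra.
have [p [q [p0 q0 hpq]]] := density_approx hu e20.
have pR : 0 < p%:R :> R by rewrite ltr0n. have qR : 0 < q%:R :> R by rewrite ltr0n.
have hcvg : (fun N : nat => (p%:R^-1 + N.+1%:R^-1) * (q%:R^-1 + N.+1%:R^-1) * u p q)
    @ \oo --> (p%:R^-1 + 0) * (q%:R^-1 + 0) * u p q.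
  apply: cvgM; last exact: cvg_cst.
  by apply: cvgM; apply: cvgD; try exact: cvg_cst; exact: cvg_harmonic.
move/cvgrPdist_le : hcvg => /(_ _ e20) hcvg.
suff : \forall N \near \oo, `|density u - u N.+1 N.+1 / (N.+1 ^ 2)%:R| <= e.
  by move=> [K _ hK]; exists K.+1 => // -[//|N] /= KN; apply: hK.
near=> N.
have h : `|(p%:R^-1 + 0) * (q%:R^-1 + 0) * u p q -
   (p%:R^-1 + N.+1%:R^-1) * (q%:R^-1 + N.+1%:R^-1) * u p q| <= e / 2.
  by near: N.
have NR : 0 < N.+1%:R :> R by rewrite ltr0n.
have lo := density_le hu (ltn0Sn N) (ltn0Sn N).
have up := bisub_bound hu N.+1 N.+1 p0 q0.
have E : (N.+1%:R / p%:R + 1) * (N.+1%:R / q%:R + 1) * u p q =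
  (p%:R^-1 + N.+1%:R^-1) * (q%:R^-1 + N.+1%:R^-1) * u p q * (N.+1%:R * N.+1%:R).
  by field; rewrite !gt_eqF.
have hpq' : (p%:R^-1 + 0) * (q%:R^-1 + 0) * u p q < density u + e / 2.
  rewrite !addr0 -invfM mulrC ltr_pdivrMr ?mulr_gt0//.
rewrite -ler_pdivlMr ?mulr_gt0// in lo.
rewrite expnS expn1 natrM distrC ler_norml; apply/andP; split; first by rewrite lerBrDr (le_trans _ lo)//; lra.
rewrite lerBlDr ler_pdivrMr ?mulr_gt0//; apply: le_trans up _; rewrite E.
rewrite ler_pM2r ?mulr_gt0//.
move: h hpq'; move: (_ * u p q) (_ * u p q) => Y Z; rewrite ler_norml; lra.
Unshelve. all: by end_near.
Qed.

Lemma subadditive_cvg (v : nat -> R) : (forall n, 0 <= v n) ->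
  {homo v : n m / (n <= m)%N >-> n <= m} ->
  (forall n m, v (n + m)%N <= v n + v m) ->
  cvgn (fun n => v n / n%:R).
Proof.
move=> v0 vm va.
(* The weight M makes the one-variable Fekete lemma an instance of density_cvg. *)
have hu : bisubadditive (fun N M => v N * M%:R).
  split=> [N M|N N' M h|N M M' h|N N' M|N M M'].
  - by rewrite mulr_ge0.
  - by rewrite ler_wpM2r// vm.
  - by rewrite ler_wpM2l// ler_nat.
  - by rewrite -mulrDl ler_wpM2r.
  - by rewrite natrD mulrDr.
apply/cvg_ex; exists (density (fun N M => v N * M%:R)).
have := density_cvg hu; apply: cvg_trans; apply: near_eq_cvg.
near=> n; have n0 : n%:R != 0 :> R by rewrite pnatr_eq0 -lt0n; near: n; exists 1%N.
by rewrite expnS expn1 natrM; field.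
Unshelve. all: by end_near.
Qed.

End biadditive.

(** * Covering numbers of rectangles *)

Section rectangles.
Variables (R : realType) (T : Type) (X : set T) (d : T -> T -> R) (f g : T -> T).
Variables (b a : R).

(** The constant [b] only keeps preimages open and metrics comparable, whereas [a] is the expansion
    rate whose logarithm appears in the final formula. *)
Record commuting_system : Prop := CommutingSystem {
  sys_pseudo : is_pseudometric d;
  sys_compact : relatively_compact X d;
  sys_neq0 : X !=set0;
  sys_fX : forall x, X x -> X (f x);
  sys_gX : forall x, X x -> X (g x);
  sys_comm : forall x, f (g x) = g (f x);
  sys_b : 0 < b;
  sys_a : 1 < a;
  sys_fL : forall x y, d (f x) (f y) <= b * d x y;
  sys_gL : forall x y, d (g x) (g y) <= a * d x y }.

(** The rectangles with M = 1 give the metric d_N of the mean dimensions, and the squares give the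
    metric of the entropy of the joint action. *)
Definition drect (N M : nat) (x y : T) : R :=
  \big[Num.max/0]_(m < N) \big[Num.max/0]_(n < M)
    d (iter m f (iter n g x)) (iter m f (iter n g y)).

Lemma drect_leP N M x y c : 0 <= c ->
  (drect N M x y <= c) <-> (forall m n, (m < N)%N -> (n < M)%N ->
    d (iter m f (iter n g x)) (iter m f (iter n g y)) <= c).
Proof.
move=> c0; split=> [/bigmax_leP[_ h] m n mN nM|h].
  by have /bigmax_leP[_ /(_ (Ordinal nM) isT)] := h (Ordinal mN) isT.
apply/bigmax_leP; split=> // i _; apply/bigmax_leP; split=> // j _; exact: h.
Qed.

Lemma drect_ge0 N M x y : 0 <= drect N M x y.
Proof. exact: bigmax_ge_id. Qed.

Lemma drect_ub N M x y m n : (m < N)%N -> (n < M)%N ->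
  d (iter m f (iter n g x)) (iter m f (iter n g y)) <= drect N M x y.
Proof. by move=> mN nM; apply: (drect_leP N M x y (drect_ge0 N M x y)).1. Qed.

Lemma drect_mono N N' M M' x y : (N <= N')%N -> (M <= M')%N ->
  drect N M x y <= drect N' M' x y.
Proof.
move=> NN MM; apply/drect_leP; first exact: drect_ge0.
by move=> m n mN nM; apply: drect_ub; apply: leq_trans; eassumption.
Qed.

Lemma dyn_dist_drect N : (forall x y, 0 <= d x y) -> dyn_dist f d N = drect N 1.
Proof.
move=> d0; apply/funext => x; apply/funext => y; rewrite /dyn_dist /drect.
by apply: eq_bigr => i _; rewrite big_ord_recl big_ord0 max_l.
Qed.

Lemma dyn_dist2_drect N : dyn_dist2 f g d N = drect N N.
Proof. by []. Qed.

Hypothesis sys : commuting_system.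
Let hd : is_pseudometric d := sys_pseudo sys.

Let a0 : 0 < a. Proof. by apply: lt_trans (sys_a sys). Qed.

Lemma iter_fX n x : X x -> X (iter n f x).
Proof. by move=> Xx; elim: n => //= n; exact: sys_fX sys _. Qed.

Lemma iter_gX n x : X x -> X (iter n g x).
Proof. by move=> Xx; elim: n => //= n; exact: sys_gX sys _. Qed.

Lemma iter_fL n x y : d (iter n f x) (iter n f y) <= b ^+ n * d x y.
Proof.
elim: n => [|n IH]; first by rewrite mul1r.
rewrite !iterS exprS -mulrA; apply: le_trans (sys_fL sys _ _) _.
by rewrite ler_pM2l ?(sys_b sys).
Qed.

Lemma iter_gL n x y : d (iter n g x) (iter n g y) <= a ^+ n * d x y.
Proof.
elim: n => [|n IH]; first by rewrite mul1r.
rewrite !iterS exprS -mulrA; apply: le_trans (sys_gL sys _ _) _.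
by rewrite ler_pM2l.
Qed.

Lemma iter_comm m n x : iter m f (iter n g x) = iter n g (iter m f x).
Proof.
have fg k y : f (iter k g y) = iter k g (f y).
  by elim: k => //= k <-; rewrite (sys_comm sys).
by elim: m => //= m ->.
Qed.

Lemma drect_lipschitz N M :
  exists2 L : R, 0 < L & forall x y, drect N M x y <= L * d x y.
Proof.
pose B := Num.max 1 b.
have B1 : 1 <= B by rewrite le_max lexx.
have B0 : 0 < B by apply: lt_le_trans B1.
exists (B ^+ N * a ^+ M); first by rewrite mulr_gt0// exprn_gt0.
move=> x y; have dxy := pseudo_ge0 hd x y.
apply/drect_leP; first by rewrite !mulr_ge0 ?exprn_ge0 ?(ltW B0) ?(ltW a0).
move=> m n mN nM; apply: le_trans (iter_fL _ _ _) _.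
rewrite -mulrA; apply: ler_pM; rewrite ?exprn_ge0 ?(ltW (sys_b sys))// ?(pseudo_ge0 hd)//.
  apply: (@le_trans _ _ (B ^+ m)); last by apply: ler_weXn2l => //; exact: ltnW.
  by apply: lerXn2r; rewrite ?nnegrE ?(ltW (sys_b sys)) ?(ltW B0)// le_max lexx orbT.
apply: le_trans (iter_gL _ _ _) _; apply: ler_wpM2r => //.
by apply: ler_weXn2l; [exact: ltW (sys_a sys)|exact: ltnW].
Qed.

Lemma drect_ge N M x y : (0 < N)%N -> (0 < M)%N -> d x y <= drect N M x y.
Proof. by move=> N0 M0; apply: (@drect_ub N M x y 0 0). Qed.

(** Each iterate of [g] stretches distances at most by [a], and [k.+1] columns involve the iterates
    0 to [k]. This lets sets of small diameter be followed for a long time under [g]. *)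
Lemma drect_scale N k x y : drect N k.+1 x y <= a ^+ k * drect N 1 x y.
Proof.
apply/drect_leP; first by rewrite mulr_ge0 ?exprn_ge0 ?drect_ge0 ?(ltW a0).
move=> m n mN nk; rewrite !iter_comm; apply: le_trans (iter_gL _ _ _) _.
apply: ler_pM; rewrite ?exprn_ge0 ?(ltW a0) ?(pseudo_ge0 hd)//.
  by apply: ler_weXn2l; [exact: ltW (sys_a sys)|].
by have := @drect_ub N 1 x y m 0 mN isT.
Qed.

Lemma drect_splitl N N' M x y : drect (N + N') M x y <=
  Num.max (drect N M x y) (drect N' M (iter N f x) (iter N f y)).
Proof.
apply/drect_leP; first by rewrite le_max drect_ge0.
move=> m n; have [mN _|Nm] := ltnP m N; first by move=> nM; rewrite le_max drect_ub.
rewrite -{1}(subnKC Nm) ltn_add2l => mN' nM; rewrite le_max; apply/orP; right.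
have := @drect_ub N' M (iter N f x) (iter N f y) _ _ mN' nM.
by rewrite -!iter_comm -!iterD subnK.
Qed.

Lemma drect_splitr N M M' x y : drect N (M + M') x y <=
  Num.max (drect N M x y) (drect N M' (iter M g x) (iter M g y)).
Proof.
apply/drect_leP; first by rewrite le_max drect_ge0.
move=> m n mN; have [nM _|Mn] := ltnP n M; first by rewrite le_max drect_ub.
rewrite -{1}(subnKC Mn) ltn_add2l => nM'; rewrite le_max; apply/orP; right.
have := @drect_ub N M' (iter M g x) (iter M g y) _ _ mN nM'.
by rewrite -!iterD subnK.
Qed.

Definition rect_cover N M c : nat := mincover X d (drect N M) c.

(** * Covering numbers of rectangles at a fixed scale *)

Section scale.
Variable c : R.
Hypothesis c0 : 0 < c.

Lemma rect_coverable N M : exists n, coverable X d (drect N M) c n.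
Proof.
have [L L0 hL] := drect_lipschitz N M.
exact: (coverable_lipschitz hd (sys_compact sys) c0 L0 hL).
Qed.

Lemma rect_cover_gt0 N M : (0 < rect_cover N M c)%N.
Proof. by apply: mincover_gt0 (sys_neq0 sys) (rect_coverable _ _). Qed.

(** A maximum over no column is 0, so [X] alone is an admissible cover. This value starts the
    renewal induction. *)
Lemma rect_cover0 N : rect_cover N 0 c = 1%N.
Proof.
apply/eqP; rewrite eqn_leq rect_cover_gt0 andbT.
apply: (mincoverP (rect_coverable N 0)).2; exists (fun=> X); split.
- by move=> _; split=> // x Xx; exists 1.
- move=> _; apply: (@diam_lt _ _ _ _ 0) => // x y _ _.
  by apply/drect_leP.
- by move=> x Xx; exists ord0.
Qed.

Lemma rect_coverE N M : (0 < N)%N -> (0 < M)%N ->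
  covering_number X (drect N M) c = (rect_cover N M c)%:R%:E.
Proof.
move=> N0 M0; have [L L0 hL] := drect_lipschitz N M.
apply: covering_numberE (rect_coverable N M) _ _ => //; last by exists L.
by exists 1 => // x y; rewrite mul1r; exact: drect_ge.
Qed.

Lemma rect_cover_mono N N' M M' : (N <= N')%N -> (M <= M')%N ->
  (rect_cover N M c <= rect_cover N' M' c)%N.
Proof.
move=> NN MM; apply: mincover_mono (rect_coverable _ _) _.
move=> U /diam_ltW[e [e0 ec _ h]] _; apply: (diam_lt e0 ec) => x y Ux Uy.
by apply: le_trans (h x y Ux Uy); exact: drect_mono.
Qed.

(** Instance of [mincover_split] in which every member is refined along the same iterate, so that
    the sum becomes a product. *)
Lemma rect_cover_mull N N' M :
  (rect_cover (N + N') M c <= rect_cover N M c * rect_cover N' M c)%N.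
Proof.
have [[U [oU dU XU]] _] := mincoverP (rect_coverable N M).
have := @mincover_split _ _ X d _ U (fun=> drect N M) (fun=> drect N' M)
  (fun=> iter N f) (fun=> b ^+ N) (drect (N + N') M) c oU XU dU.
rewrite sum_nat_const card_ord; apply.
- by move=> _; exact: rect_coverable.
- by move=> _; exact: iter_fX.
- by move=> _; rewrite exprn_gt0// (sys_b sys).
- by move=> _; exact: iter_fL.
- by move=> _; exact: drect_splitl.
Qed.

Lemma rect_cover_mulr N M M' :
  (rect_cover N (M + M') c <= rect_cover N M c * rect_cover N M' c)%N.
Proof.
have [[U [oU dU XU]] _] := mincoverP (rect_coverable N M).
have := @mincover_split _ _ X d _ U (fun=> drect N M) (fun=> drect N M')
  (fun=> iter M g) (fun=> a ^+ M) (drect N (M + M')) c oU XU dU.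
rewrite sum_nat_const card_ord; apply.
- by move=> _; exact: rect_coverable.
- by move=> _; exact: iter_gX.
- by move=> _; rewrite exprn_gt0.
- by move=> _; exact: iter_gL.
- by move=> _; exact: drect_splitr.
Qed.

Definition rect_entropy N M : R := ln (rect_cover N M c)%:R.

Lemma ler_ln_nat (m n : nat) : (0 < m)%N -> (m <= n)%N -> ln m%:R <= ln n%:R :> R.
Proof.
by move=> m0 mn; rewrite ler_ln ?posrE ?ltr0n ?ler_nat//; apply: leq_trans mn.
Qed.

Lemma rect_entropy_bisub : bisubadditive rect_entropy.
Proof.
split=> [N M|N N' M h|N M M' h|N N' M|N M M']; rewrite /rect_entropy.
- by rewrite ln_ge0// ler1n rect_cover_gt0.
- by apply: ler_ln_nat; rewrite ?rect_cover_gt0// rect_cover_mono.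
- by apply: ler_ln_nat; rewrite ?rect_cover_gt0// rect_cover_mono.
- rewrite -lnM ?posrE ?ltr0n ?rect_cover_gt0// -natrM.
  by apply: ler_ln_nat (rect_cover_gt0 _ _) (rect_cover_mull _ _ _).
- rewrite -lnM ?posrE ?ltr0n ?rect_cover_gt0// -natrM.
  by apply: ler_ln_nat (rect_cover_gt0 _ _) (rect_cover_mulr _ _ _).
Qed.

Lemma lne_rect_cover N M : (0 < N)%N -> (0 < M)%N ->
  lne (covering_number X (drect N M) c) = (rect_entropy N M)%:E.
Proof.
by move=> N0 M0; rewrite rect_coverE// lne_EFin// ltr0n rect_cover_gt0.
Qed.

End scale.

Lemma htop_scaleE c : 0 < c ->
  (fun N : nat => (lne (covering_number X (dyn_dist2 f g d N) c) / (N ^ 2)%:R%:E)%E)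
    @ \oo --> (density (rect_entropy c))%:E.
Proof.
move=> c0; have h := density_cvg (rect_entropy_bisub c0).
have : (fun N : nat => (rect_entropy c N N / (N ^ 2)%:R)%:E) @ \oo -->
  (density (rect_entropy c))%:E by apply/fine_cvgP; split; [exact: nearW|].
apply: cvg_trans; apply: near_eq_cvg; near=> N.
have N0 : (0 < N)%N by near: N; exists 1%N.
rewrite dyn_dist2_drect lne_rect_cover// inver ifF ?EFinM//.
by rewrite pnatr_eq0 expn_eq0 andbT gtn_eqF.
Unshelve. all: by end_near.
Qed.

(** The growth rate along [f] alone, which is the numerator of the metric mean dimension at scale
    [c]. *)
Definition orbit_rate c : R := limn (fun N : nat => rect_entropy c N 1 / N%:R).

Lemma orbit_rate_cvg c : 0 < c ->
  (fun N : nat => rect_entropy c N 1 / N%:R) @ \oo --> orbit_rate c.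
Proof.
move=> c0; have hu := rect_entropy_bisub c0.
apply: (subadditive_cvg (v := fun N => rect_entropy c N 1)) => [n|n m nm|n m].
- exact: bisub_ge0 hu _ _.
- exact: (bisub_monol hu 1%N nm).
- exact: (bisub_addl hu n m 1%N).
Qed.

Lemma dimM_scale_cvg e : 0 < e -> e < 1 ->
  (fun N : nat => (dimM X (dyn_dist f d N) e / N%:R%:E)%E) @ \oo -->
    (orbit_rate e / ln e^-1)%:E.
Proof.
move=> e0 e1; have l0 : 0 < ln e^-1 by rewrite ln_gt0// invf_gt1.
have h : (fun N : nat => (rect_entropy e N 1 / N%:R / ln e^-1)%:E) @ \oo -->
  (orbit_rate e / ln e^-1)%:E.
  apply/fine_cvgP; split; first exact: nearW.
  by apply: cvgM; [exact: orbit_rate_cvg|exact: cvg_cst].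
apply: cvg_trans h; apply: near_eq_cvg; near=> N.
have N0 : (0 < N)%N by near: N; exists 1%N.
rewrite /dimM dyn_dist_drect; last exact: pseudo_ge0 hd.
rewrite lne_rect_cover// div1r !inver !ifF ?gt_eqF ?ltr0n//.
by rewrite -!EFinM mulrAC.
Unshelve. all: by end_near.
Qed.

Lemma mdimM_scaleE e : 0 < e -> e < 1 ->
  mdimM_scale X f d e = (orbit_rate e / ln e^-1)%:E.
Proof. by move=> e0 e1; apply/cvg_lim => //; exact: dimM_scale_cvg. Qed.

End rectangles.

(** * Hausdorff sums *)

Section hausdorff_covers.
Variables (R : realType) (T : Type) (X : set T).
Implicit Types (d D : T -> T -> R).

Lemma diam_pow_ge0 D s E : (0 <= diam_pow D s E)%E.
Proof. by rewrite /diam_pow; case: ifP => // _; exact: poweR_ge0. Qed.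

(** For nonzero [s] the convention for the empty set agrees with 0^s = 0, so the case distinction
    disappears. *)
Lemma diam_powE D s E (b : R) : s != 0 -> diam D E = b%:E ->
  diam_pow D s E = (b `^ s)%:E.
Proof.
move=> s0 hb; rewrite /diam_pow; case: asboolP => [E0|_]; last by rewrite hb poweR_EFin.
have b0 : b = 0.
  have : (diam D E <= 0%:E)%E by apply: diam_le => // x y; rewrite E0.
  have := diam_ge0 D E; rewrite hb !lee_fin => h1 h2.
  by apply/eqP; rewrite eq_le h1 h2.
by rewrite b0 powR0.
Qed.

(** Some member of the cover is nonempty and contributes 1, also when its diameter is 0. Hence the
    set whose supremum is [dimH] contains 0. *)
Lemma hausdorff0_ge1 D e : X !=set0 -> (1 <= hausdorff X D e 0)%E.
Proof.
move=> [x Xx]; apply: le_ereal_inf_tmp => _ [E [XE _] <-].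
have [i _ Eix] : (\bigcup_i E i) x by rewrite -XE.
apply: le_trans (nneseries_lim_ge i.+1 _) => [|k _ _]; last exact: diam_pow_ge0.
rewrite big_nat_recr//= -[leLHS]add0e; apply: leeD.
  by apply: sume_ge0 => k _; exact: diam_pow_ge0.
rewrite /diam_pow; case: asboolP => [E0|_]; first by rewrite E0 in Eix.
by rewrite poweRe0.
Qed.

Lemma hausdorff_le_cover d D e s n : 0 < s -> 0 < e -> coverable X d D e n ->
  (hausdorff X D e s <= (n%:R * e `^ s)%:E)%E.
Proof.
move=> s0 e0 [U [oU dU XU]].
(* The finite cover is continued by empty sets, which contribute 0 to the sum. *)
pose E k := if insub k is Some i then U i else set0.
have hE k : (diam D (E k) < e%:E)%E.
  by rewrite /E; case: insub => // ; apply: (@diam_lt _ _ _ _ 0).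
have EU (i : 'I_n) : E i = U i by rewrite /E valK.
apply: (@le_trans _ _ (\sum_(0 <= i <oo) diam_pow D s (E i))%E).
  apply: ereal_inf_lbound; exists E => //; split => //.
  apply/seteqP; split=> [x /XU[i _ Ui]|x [k _]]; first by exists i; rewrite // EU.
  by rewrite /E; case: insub => // i /(oU i).1.
rewrite (nneseries_split 0 n) => [|k _]; last exact: diam_pow_ge0.
rewrite [X in (_ + X)%E]eseries0 => [|k nk _]; last first.
  have -> : E k = set0 by rewrite /E insubF// ltnNge -(add0n n) nk.
  by rewrite /diam_pow asboolT.
rewrite adde0 add0n big_mkord mulr_natl.
have -> : e `^ s *+ n = \sum_(i < n) e `^ s by rewrite sumr_const card_ord.
rewrite -sumEFin.
apply: lee_sum => i _; have [b [b0 be hb _]] := diam_ltW (hE i).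
rewrite (diam_powE _ hb) ?gt_eqF// lee_fin.
by apply: ge0_ler_powR; rewrite ?nnegrE// ltW.
Qed.

(** If the Hausdorff sum is at least 1, the finite cover gives 1 <= n e^s; taking logarithms bounds
    s. *)
Lemma dimH_le_dimM d D e n : 0 < e -> e < 1 -> coverable X d D e n -> (0 < n)%N ->
  (dimH X D e <= (ln n%:R / ln e^-1)%:E)%E.
Proof.
move=> e0 e1 cov n0; have l0 : 0 < ln e^-1 by rewrite ln_gt0// invf_gt1.
apply: ge_ereal_sup => _ [s [s0 hs] <-]; rewrite lee_fin ler_pdivlMr//.
have [->|sn0] := eqVneq s 0; first by rewrite mul0r ln_ge0// ler1n.
have {s0 sn0}s0 : 0 < s by rewrite lt_def sn0.
have := le_trans hs (hausdorff_le_cover s0 e0 cov); rewrite lee_fin => h.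
have p0 : 0 < e `^ s by rewrite powR_gt0.
have : 0 <= ln (n%:R * e `^ s) by rewrite ln_ge0.
rewrite lnM ?posrE ?ltr0n// ln_powR lnV ?posrE//; lra.
Qed.

(** The strict inequality leaves a slack [eta], which is shared out geometrically among the sets to
    make them open; compactness then leaves finitely many. *)
Lemma hausdorff_open_cover d D (L s e : R) : is_pseudometric D -> 0 < L ->
  (forall x y, D x y <= L * d x y) -> relatively_compact X d -> X !=set0 ->
  0 < s -> (hausdorff X D e s < 1)%E ->
  exists n (U : 'I_n -> set T) (r : 'I_n -> R),
    [/\ forall i, relatively_open X d (U i), X `<=` \bigcup_i U i,
        forall i, 0 < r i < e, forall i, (diam D (U i) < (r i)%:E)%E
      & \sum_i r i `^ s < 1].
Proof.
move=> hD L0 DL Xc X0 s0 /ereal_inf_lt[_ [E [XE dE] <-]] hsum.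
have /choice[b hb] : forall i, exists b, [/\ 0 <= b, b < e, diam D (E i) = b%:E
    & forall x y, E i x -> E i y -> D x y <= b] by move=> i; exact: diam_ltW.
set S := (\sum_(0 <= i <oo) _)%E in hsum.
have S0 : (0 <= S)%E by apply: nneseries_ge0 => k _ _; exact: diam_pow_ge0.
have Sfin : S \is a fin_num by rewrite ge0_fin_numE// (lt_trans hsum)// ltry.
have S1 : fine S < 1 by rewrite -lte_fin fineK.
pose eta := 1 - fine S; have eta0 : 0 < eta by rewrite subr_gt0.
pose v i := eta / 2 ^+ i.+1.
have v0 i : 0 < v i by rewrite divr_gt0// exprn_gt0.
have /choice[r hr] : forall i, exists r, [/\ 0 < r, b i < r, r < e & r `^ s <= b i `^ s + v i].
  (* The number [u] is where the s-th power has used up the share [v i]; [r i] is the midpoint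
     between [b i] and the smaller of [e] and [u]. *)
  move=> i; have [b0 be _ _] := hb i; pose u := (b i `^ s + v i) `^ s^-1.
  have bu : b i < u.
    rewrite -[ltLHS](powRr1 b0) -[X in _ `^ X](mulfV (lt0r_neq0 s0)) powRrM.
    by apply: gt0_ltr_powR; rewrite ?invr_gt0// ?nnegrE ?addr_ge0 ?powR_ge0 ?(ltW (v0 i))// ltrDl.
  have bm : b i < Num.min e u by rewrite lt_min be.
  have me : Num.min e u <= e by rewrite ge_min lexx.
  have mu : Num.min e u <= u by rewrite ge_min lexx orbT.
  exists ((b i + Num.min e u) / 2); split; [lra|lra|lra|].
  have -> : b i `^ s + v i = u `^ s.
    by rewrite /u -powRrM mulVf ?gt_eqF// powRr1// addr_ge0 ?powR_ge0 ?(ltW (v0 i)).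
  by apply: ge0_ler_powR; rewrite ?nnegrE ?powR_ge0 ?(ltW s0)//; lra.
(* The thickening adds two thirds of [r i - b i], so the diameter stays strictly below [r i]. *)
pose U i := thickening X D (E i) ((r i - b i) / 3).
have EX i : E i `<=` X by move=> x Ex; rewrite XE; exists i.
have oU i : relatively_open X d (U i).
  exact: rel_open_lipschitz L0 DL (thickening_open _ _ _ hD).
have XU : X `<=` \bigcup_i U i.
  move=> x; rewrite {1}XE => -[i _ Eix]; exists i => //.
  by apply: sub_thickening => //; have [_ br _ _] := hr i; rewrite divr_gt0// subr_gt0.
have dU i : (diam D (U i) < (r i)%:E)%E.
  have [b0 _ _ Db] := hb i; have [_ br _ _] := hr i.
  apply: (@diam_lt _ _ _ _ (b i + 2 * ((r i - b i) / 3))); [lra|lra|].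
  exact: thickening_diam.
have [n Xn] := relatively_compact_nat X0 Xc oU XU.
exists n, (fun i => U i), (fun i => r i); split=> //.
- by move=> x /Xn[i /= ni Ui]; exists (Ordinal ni).
- by move=> i; have [-> _ -> _] := hr i.
have hb' : \sum_(i < n) b i `^ s <= fine S.
  rewrite -lee_fin fineK// -sumEFin.
  have := @nneseries_lim_ge _ (fun i => diam_pow D s (E i)) xpredT 0 n
    (fun k _ _ => diam_pow_ge0 D s (E k)).
  rewrite big_mkord; apply: le_trans; apply: lee_sum => i _.
  by have [_ _ hbi _] := hb i; rewrite (diam_powE _ hbi) ?gt_eqF.
have hv : forall m, \sum_(i < m) v i = eta * (1 - 2^-1 ^+ m).
  elim=> [|m IH]; first by rewrite big_ord0 expr0 subrr mulr0.
  by rewrite big_ord_recr/= IH /v !exprS invfM -exprVn; field.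
apply: (@le_lt_trans _ _ (\sum_(i < n) (b i `^ s + v i))).
  by apply: ler_sum => i _; have [] := hr i.
rewrite big_split/= hv; have p2 : 0 < 2^-1 ^+ n :> R by rewrite exprn_gt0// invr_gt0.
have : 0 < eta * 2^-1 ^+ n by rewrite mulr_gt0.
by move: hb'; rewrite /eta; move: (2^-1 ^+ n); set Z := \sum_(i < n) _ => y; lra.
Qed.

End hausdorff_covers.

(** * Growth of covering numbers *)

Lemma exists_pow_floor (R : realType) (a x : R) : 1 < a -> 1 <= x -> exists k : nat, a ^+ k <= x < a ^+ k.+1.
Proof.
move=> a1 x1; have a0 : 0 < a by apply: lt_trans a1.
have lna0 := ln_gt0 a1; have x0 : 0 < x by apply: lt_le_trans x1.
have h0 : 0 <= ln x / ln a by apply: divr_ge0; [exact: ln_ge0|exact: ltW].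
have /andP[k1 k2] := truncn_itv h0; exists (Num.trunc (ln x / ln a)); apply/andP; split.
  by rewrite -ler_ln ?posrE ?exprn_gt0// lnXn// -mulr_natl -ler_pdivlMr.
by rewrite -ltr_ln ?posrE ?exprn_gt0// lnXn// -mulr_natl -ltr_pdivrMr.
Qed.

Section growth_rates.
Variables (R : realType) (T : Type) (X : set T) (d : T -> T -> R) (f g : T -> T).
Variables (b a : R).
Hypothesis sys : commuting_system X d f g b a.
Let hd : is_pseudometric d := sys_pseudo sys.
Let a0 : 0 < a. Proof. by apply: lt_trans (sys_a sys). Qed.
Let lna0 : 0 < ln a. Proof. exact: ln_gt0 (sys_a sys). Qed.

Lemma drect_pseudometric N M : is_pseudometric (drect d f g N M).
Proof.
split=> [x|x y|x y z].
- apply/eqP; rewrite eq_le drect_ge0 andbT; apply/drect_leP => // m n _ _.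
  by rewrite (pseudo_refl hd).
- by apply: eq_bigr => i _; apply: eq_bigr => j _; rewrite (pseudo_sym hd).
- apply/drect_leP; first by rewrite addr_ge0 ?drect_ge0.
  move=> m n mN nM; apply: le_trans (pseudo_tri hd _ (iter m f (iter n g y)) _) _.
  by apply: lerD; exact: drect_ub.
Qed.

(** Strong induction on [M]: refining [U i] along [iter (k i) g] leaves [M - k i] columns, and the
    weights w^-(k_i) add up to at most 1. The factor [w ^+ K] pays for the members whose [k i]
    exceeds the columns left. *)
Lemma rect_cover_renewal n (U : 'I_n -> set T) (k : 'I_n -> nat) (w c : R) N :
  0 < c -> 1 <= w -> (forall i, relatively_open X d (U i)) ->
  X `<=` \bigcup_i U i -> (forall i, 0 < k i)%N ->
  (forall i, (diam (drect d f g N (k i)) (U i) < c%:E)%E) ->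
  \sum_i w ^- k i <= 1 ->
  forall M, (rect_cover X d f g N M c)%:R <= w ^+ (\max_i k i) * w ^+ M.
Proof.
move=> c0 w1 oU XU k0 dU sk M; set K := (\max_i k i)%N.
have w0 : 0 < w by apply: lt_le_trans w1.
elim/ltn_ind: M => -[|M] IH.
  by rewrite (rect_cover0 sys)// mulr1 exprn_ege1.
have : (rect_cover X d f g N M.+1 c <= \sum_i rect_cover X d f g N (M.+1 - k i) c)%N.
  apply: (@mincover_split _ _ X d _ U (fun i => drect d f g N (k i))
    (fun i => drect d f g N (M.+1 - k i)) (fun i => iter (k i) g)
    (fun i => a ^+ k i)) => // [i|i|i|i|i x y].
  - exact: (rect_coverable sys).
  - exact: (iter_gX sys).
  - by rewrite exprn_gt0.
  - exact: (iter_gL sys).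
  - have [kM|Mk] := leqP (k i) M.+1.
      by rewrite -{1}(subnKC kM); exact: drect_splitr.
    by rewrite le_max (drect_mono d f g x y (leqnn N) (ltnW Mk)).
rewrite -(ler_nat R) natr_sum => h; apply: le_trans h _.
apply: (@le_trans _ _ (\sum_i w ^+ K * w ^+ M.+1 * w ^- k i)); last first.
  by rewrite -mulr_sumr ler_piMr// mulr_ge0// exprn_ge0// ltW.
apply: ler_sum => i _.
have kK : (k i <= K)%N by exact: leq_bigmax.
have [kM|Mk] := leqP (k i) M.+1.
  apply: le_trans (IH _ _) _; first by rewrite ltn_subrL k0.
  by rewrite -mulrA expfB_cond ?gt_eqF.
(* Here the truncated difference is 0 and [U i] is already small enough; the term 1 is below the
   bound since [k i <= K]. *)
rewrite (eqP (ltnW Mk : _ == _)) (rect_cover0 sys)// ler_pdivlMr ?exprn_gt0// mul1r.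
rewrite -exprD; apply: ler_weXn2l => //; exact: leq_trans (leq_addr _ _).
Qed.

Lemma density_le_of_growth (u : nat -> nat -> R) N (A B : R) : bisubadditive u ->
  (0 < N)%N -> (forall M, u N M <= A + M%:R * B) -> density u * N%:R <= B.
Proof.
move=> hu N0 h; rewrite leNgt; apply/negP => lt.
have e0 : 0 < density u * N%:R - B by rewrite subr_gt0.
have A0 : 0 <= A by have := h 0%N; have := bisub_ge0 hu N 0; lra.
(* With [M] beyond [A] divided by the gap of slopes, the linear lower bound overtakes the upper
   one. *)
have := truncn_itv (divr_ge0 A0 (ltW e0)) => /andP[_]; set M := (Num.trunc _).+1.
rewrite ltr_pdivrMr// => AM; have := density_le hu N0 (ltn0Sn _ : (0 < M)%N).
by have := h M; rewrite mulrA; lra.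
Qed.

(** Furstenberg's argument. The condition on [t] says e <= c^((1+t)/t): the scale [e] is so small
    that replacing r by r/c costs only a factor 1 + t in the exponent. *)
Lemma entropy_le_hausdorff (c e t s : R) N : 0 < c -> e <= c -> 0 < t ->
  t * ln e <= (1 + t) * ln c -> (0 < N)%N -> 0 < s ->
  (hausdorff X (drect d f g N 1) e s < 1)%E ->
  density (rect_entropy X d f g c) * N%:R <= s * ((1 + t) * ln a).
Proof.
move=> c0 ec t0 tec N0 s0 hs; have [L L0 hL] := drect_lipschitz sys N 1.
have [n [U [r [oU XU r0 dU sr]]]] := hausdorff_open_cover (drect_pseudometric N 1)
  L0 hL (sys_compact sys) (sys_neq0 sys) s0 hs.
(* The lower bound on c / r_i keeps [U i] small along [(k i).+1] columns; the upper bound gives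
   a^-(k_i + 1) < r_i / c. *)
have /choice[k hk] : forall i, exists k, a ^+ k <= c / r i < a ^+ k.+1.
  move=> i; have /andP[ri re] := r0 i; apply: exists_pow_floor; first exact: sys_a sys.
  by rewrite ler_pdivlMr// mul1r ltW// (lt_le_trans re).
(* With this base, w^-(k_i + 1) < (r_i / c)^(s (1+t)) <= r_i^s, where the last inequality uses [tec]
   and r_i < e. The weights thus add up to less than 1. *)
pose w := a `^ (s * (1 + t)).
have st0 : 0 < s * (1 + t) by rewrite mulr_gt0//; lra.
have w0 : 0 < w by rewrite powR_gt0.
have lw : ln w = s * ((1 + t) * ln a) by rewrite ln_powR mulrA.
have w1 : 1 <= w by rewrite -ler_ln ?posrE// ln1 lw mulrA mulr_ge0// ltW.
have growth := rect_cover_renewal c0 w1 oU XU (fun i => ltn0Sn (k i)) _ _.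
rewrite -lw; pose K := (\max_i (k i).+1)%N.
apply: (density_le_of_growth (A := K%:R * ln w) (rect_entropy_bisub sys c0) N0) => M.
rewrite /rect_entropy -mulrDl -natrD mulr_natl -lnXn// exprD ler_ln ?posrE ?mulr_gt0 ?exprn_gt0//.
  apply: growth => [i|].
    have /andP[ri _] := r0 i; have /andP[kc _] := hk i.
    have [b' [b0 br _ Db]] := diam_ltW (dU i).
    rewrite ler_pdivlMr// in kc.
    apply: (@diam_lt _ _ _ _ (a ^+ k i * b')); first by rewrite mulr_ge0// exprn_ge0// ltW.
      by apply: lt_le_trans kc; rewrite ltr_pM2l// exprn_gt0.
    move=> x y Ux Uy; apply: le_trans (drect_scale sys _ _ _ _) _.
    by rewrite ler_pM2l ?exprn_gt0// Db.
  apply/ltW; apply: le_lt_trans sr; apply: ler_sum => i _.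
  have /andP[ri re] := r0 i; have /andP[_ kc] := hk i.
  have e0 : 0 < e by apply: lt_trans re.
  have lkc : ln c - ln (r i) <= (k i).+1%:R * ln a.
    by rewrite -ln_div ?posrE// mulr_natl -lnXn// ler_ln ?posrE ?divr_gt0 ?exprn_gt0// ltW.
  have lre : ln (r i) <= ln e by rewrite ler_ln ?posrE// ltW.
  rewrite -ler_ln ?posrE ?invr_gt0 ?exprn_gt0 ?powR_gt0// lnV ?posrE ?exprn_gt0//.
  rewrite lnXn// ln_powR lw -mulr_natl.
  have h1 : s * (1 + t) * (ln c - ln (r i)) <= s * (1 + t) * ((k i).+1%:R * ln a).
    by rewrite ler_pM2l.
  have h2 : s * (t * ln (r i)) <= s * ((1 + t) * ln c).
    by rewrite ler_pM2l//; apply: le_trans tec; rewrite ler_pM2l.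
  by move: h1 h2; move: ((k i).+1%:R) => kr; nra.
by rewrite ltr0n (rect_cover_gt0 sys).
Qed.

(** For every positive exponent below the bound, a Hausdorff sum less than 1 would contradict
    [entropy_le_hausdorff]; a nonpositive one is covered by the exponent 0. *)
Lemma dimH_ge (c e t : R) N : 0 < c -> e <= c -> 0 < t ->
  t * ln e <= (1 + t) * ln c -> (0 < N)%N ->
  ((density (rect_entropy X d f g c) / ((1 + t) * ln a) * N%:R)%:E
    <= dimH X (drect d f g N 1) e)%E.
Proof.
move=> c0 ec t0 tec N0; set B := _ / _ * _.
have ta0 : 0 < (1 + t) * ln a by rewrite mulr_gt0//; lra.
have sup s : 0 <= s -> (1 <= hausdorff X (drect d f g N 1) e s)%E ->
    (s%:E <= dimH X (drect d f g N 1) e)%E.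
  by move=> s0 hs; apply: ereal_sup_ubound; exists s.
have dim0 := sup 0 (lexx _) (hausdorff0_ge1 _ e (sys_neq0 sys)).
apply/lee_addgt0Pr => eps eps0; rewrite -leeBlDr// -EFinB.
have [Be|eB] := leP (B - eps) 0; first by apply: le_trans dim0; rewrite lee_fin.
apply: sup; first exact: ltW.
rewrite leNgt; apply/negP => /(entropy_le_hausdorff c0 ec t0 tec N0 eB).
rewrite leNgt => /negP; apply.
by rewrite -ltr_pdivlMr// mulrAC -/B ltrBlDr ltrDl.
Qed.

(** * Upper bound for the metric mean dimension from expansiveness *)

Section expansive.
Variables (c C : R).
Hypothesis c0 : 0 < c.
(** Quantitative expansiveness: each iterate of [g] gains a factor [a] in resolution, and [L]
    further iterates of [f] control the tail. The bound [e / 2] makes diameters strictly less than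
    [e]. *)
Hypothesis expand : forall e, 0 < e -> e < 1 -> exists L k : nat,
  k%:R <= ln e^-1 / ln a + C /\
  forall N x y, drect d f g (N + L) k x y < c -> drect d f g N 1 x y <= e / 2.

(** A cover for the (N + L) x k rectangle at scale [c] is one for N x 1 at scale [e]. Tiling by p x
    q and dividing by N, the contribution of [L] vanishes in the limit. *)
Lemma orbit_rate_le e p q : 0 < e -> e < 1 -> (0 < p)%N -> (0 < q)%N ->
  orbit_rate X d f g e <=
  p%:R^-1 * (((ln e^-1 / ln a + C) / q%:R + 1) * rect_entropy X d f g c p q).
Proof.
move=> e0 e1 p0 q0; have [L [k [kC hk]]] := expand e0 e1.
have pR : 0 < p%:R :> R by rewrite ltr0n. have qR : 0 < q%:R :> R by rewrite ltr0n.
set u := rect_entropy X d f g c.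
have hu : bisubadditive u := rect_entropy_bisub sys c0.
set Y := (_ / _ + 1) * _.
have step N : rect_entropy X d f g e N.+1 1 <= ((N.+1 + L)%:R / p%:R + 1) * Y.
  apply: (@le_trans _ _ (u (N.+1 + L)%N k)).
    apply: ler_ln_nat (rect_cover_gt0 sys e0 _ _) _.
    apply: mincover_mono (rect_coverable sys c0 _ _) _.
    move=> U /diam_ltW[e' [e'0 ec _ h]] _; apply: (@diam_lt _ _ _ _ (e / 2)); [lra|lra|].
    by move=> x y Ux Uy; apply: (hk N.+1); apply: le_lt_trans (h _ _ Ux Uy) ec.
  apply: le_trans (bisub_bound hu _ _ p0 q0) _; rewrite -mulrA ler_pM2l; last first.
    by rewrite ltr_wpDl// divr_ge0.
  apply: ler_wpM2r; first exact: bisub_ge0 hu _ _.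
  by rewrite lerD2r ler_pM2r// invr_gt0.
have cvg1 : (fun N : nat => (p%:R^-1 + (L%:R / p%:R + 1) * N.+1%:R^-1) * Y) @ \oo -->
    (p%:R^-1 + (L%:R / p%:R + 1) * 0) * Y.
  apply: cvgM; last exact: cvg_cst.
  apply: cvgD; first exact: cvg_cst.
  by apply: cvgM; [exact: cvg_cst|exact: cvg_harmonic].
have cvg2 := orbit_rate_cvg sys e0; rewrite -cvg_shiftS in cvg2.
have := ler_cvg_to cvg2 cvg1; rewrite mulr0 addr0; apply; apply: nearW => N /=.
rewrite ler_pdivrMr ?ltr0n//; apply: le_trans (step N) _; rewrite natrD.
have := ltr0Sn R N; move: (N.+1%:R) => y y0.
by rewrite le_eqVlt; apply/orP; left; apply/eqP; field; rewrite !gt_eqF.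
Qed.

Let h := density (rect_entropy X d f g c).

Lemma mdimM_upper eta : 0 < eta ->
  \forall e \near (0 : R)^'+, orbit_rate X d f g e / ln e^-1 <= h / ln a + eta.
Proof.
move=> eta0; have hu := rect_entropy_bisub sys c0.
have eta1 : 0 < eta * ln a / 2 by rewrite divr_gt0// mulr_gt0.
have [p [q [p0 q0]]] := density_approx hu eta1; rewrite -/h => hpq.
have pR : 0 < p%:R :> R by rewrite ltr0n. have qR : 0 < q%:R :> R by rewrite ltr0n.
set u := rect_entropy X d f g c p q in hpq.
have up : u / (p%:R * q%:R) < h + eta * ln a / 2 by rewrite ltr_pdivrMr// mulr_gt0.
(* [Z] bounds the terms that do not grow with ln(1/e); the choice of [e] below makes them at most
   [eta / 2] times ln(1/e). *)
pose Z := Num.max 0 ((C / q%:R + 1) * u / p%:R).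
have Z1 : (C / q%:R + 1) * u / p%:R <= Z by rewrite le_max lexx orbT.
near=> e.
have e0 : 0 < e by near: e; exact: nbhs_right_gt.
have e1 : e < 1 by near: e; exact: nbhs_right_lt.
have eZ : e <= expR (- (2 * Z / eta)) by near: e; apply: nbhs_right_ltW; exact: expR_gt0.
have l0 : 0 < ln e^-1 by rewrite ln_gt0// invf_gt1.
have lZ : 2 * Z / eta <= ln e^-1.
  by rewrite lnV ?posrE// lerNr -(expRK (- _)) ler_ln ?posrE// expR_gt0.
rewrite ler_pdivrMr//; apply: le_trans (orbit_rate_le e0 e1 p0 q0) _; rewrite -/u.
move: (ln e^-1) lZ l0 => y lZ y0.
have -> : p%:R^-1 * (((y / ln a + C) / q%:R + 1) * u) =
  u / (p%:R * q%:R) / ln a * y + (C / q%:R + 1) * u / p%:R.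
  by field; rewrite !gt_eqF.
have h1 : u / (p%:R * q%:R) / ln a <= h / ln a + eta / 2.
  by rewrite ler_pdivrMr// mulrDl divfK ?gt_eqF//; lra.
have h2 : u / (p%:R * q%:R) / ln a * y <= (h / ln a + eta / 2) * y by rewrite ler_pM2r.
have h3 : Z <= eta / 2 * y by move: lZ; rewrite ler_pdivrMr//; lra.
by move: h2 h3 Z1; move: (_ / _ * y) (h / ln a) (_ * u / _) => ? ? ?; lra.
Unshelve. all: by end_near.
Qed.

End expansive.

End growth_rates.

(** * Mean dimensions of an expansive action *)

Section ereal_limits.
Variables (R : realType) (T : choiceType) (X : filteredType T) (F : set_system X).
Context {FF : ProperFilter F}.
Implicit Types (phi : X -> \bar R) (l : \bar R).

Lemma limf_esup_le phi l : (\forall x \near F, (phi x <= l)%E) ->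
  (limf_esup phi F <= l)%E.
Proof.
move=> h; rewrite limf_esupE; apply: le_trans (ereal_inf_lbound _) _.
  by exists [set x | (phi x <= l)%E].
by apply: ge_ereal_sup => _ [x /= hx <-].
Qed.

Lemma limf_einf_ge phi l : (\forall x \near F, (l <= phi x)%E) ->
  (l <= limf_einf phi F)%E.
Proof.
move=> h; rewrite limf_einfE; apply: le_trans (ereal_sup_ubound _); last first.
  by exists [set x | (l <= phi x)%E].
by apply: le_ereal_inf_tmp => _ [x /= hx <-].
Qed.

Lemma limf_einf_le_esup phi : (limf_einf phi F <= limf_esup phi F)%E.
Proof.
rewrite limf_esupE limf_einfE; apply: ge_ereal_sup => _ [V FV <-].
apply: le_ereal_inf_tmp => _ [W FW <-].
have [x [Vx Wx]] := filter_ex (filterI FV FW).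
apply: (@le_trans _ _ (phi x)).
  by apply: ereal_inf_lbound; exists x.
by apply: ereal_sup_ubound; exists x.
Qed.

Lemma limf_esup_einf_squeeze phi (h : R) :
  (forall e : R, 0 < e ->
    \forall x \near F, ((h - e)%:E <= phi x)%E /\ (phi x <= (h + e)%:E)%E) ->
  limf_einf phi F = h%:E /\ limf_esup phi F = h%:E.
Proof.
move=> near_h.
have up : (limf_esup phi F <= h%:E)%E.
  apply/lee_addgt0Pr => e /near_h he; apply: limf_esup_le.
  by apply: filterS he => x [].
have lo : (h%:E <= limf_einf phi F)%E.
  apply/lee_subgt0Pr => e /near_h he; apply: limf_einf_ge.
  by apply: filterS he => x [].
have mid := limf_einf_le_esup phi.
split; apply/eqP; rewrite eq_le.
  by rewrite lo (le_trans mid).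
by rewrite up (le_trans lo).
Qed.

Lemma cvg_ereal_squeeze phi (h : R) :
  (forall e : R, 0 < e ->
    \forall x \near F, ((h - e)%:E <= phi x)%E /\ (phi x <= (h + e)%:E)%E) ->
  phi @ F --> h%:E.
Proof.
move=> near_h; apply/fine_cvgP; split.
  apply: filterS (near_h 1 ltr01) => x [h1 h2].
  by rewrite fin_numE; apply/andP; split; apply/eqP => E; rewrite E in h1 h2.
apply/cvgrPdist_le => e /near_h; apply: filterS => x [] /=.
case: (phi x) => [r| |]//=; rewrite !lee_fin => h1 h2.
by rewrite ler_norml; apply/andP; split; lra.
Qed.

End ereal_limits.

(** * The chain of inequalities between entropy and the mean dimensions *)

Section mean_dimensions.
Variables (R : realType) (T : Type) (X : set T) (d : T -> T -> R) (f g : T -> T).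
Variables (b a c0 C : R).
Hypothesis sys : commuting_system X d f g b a.
Hypothesis c0_gt0 : 0 < c0.
Hypothesis expand : forall e, 0 < e -> e < 1 -> exists L k : nat,
  k%:R <= ln e^-1 / ln a + C /\
  forall N x y, drect d f g (N + L) k x y < c0 -> drect d f g N 1 x y <= e / 2.

Let hd : is_pseudometric d := sys_pseudo sys.
Let lna0 : 0 < ln a. Proof. exact: ln_gt0 (sys_a sys). Qed.

Let dyn_rect N : dyn_dist f d N = drect d f g N 1.
Proof. by apply: dyn_dist_drect; exact: pseudo_ge0 hd. Qed.

Let lowH e := limn_einf (fun N : nat => (dimH X (dyn_dist f d N) e / N%:R%:E)%E).
Let upH e := limn_esup (fun N : nat => (dimH X (dyn_dist f d N) e / N%:R%:E)%E).

Let lowH_le_upH e : (lowH e <= upH e)%E.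
Proof. exact: limn_einf_sup. Qed.

Let upH_le e : 0 < e -> e < 1 -> (upH e <= mdimM_scale X f d e)%E.
Proof.
move=> e0 e1; rewrite (mdimM_scaleE sys)//; apply/lee_addgt0Pr => eta eta0.
have /fine_cvgP[_ /cvgr_le lim] := dimM_scale_cvg sys e0 e1.
apply: limf_esup_le; near=> N.
have N0 : (0 < N)%N by near: N; exists 1%N.
have E : (dimM X (dyn_dist f d N) e / N%:R%:E)%E =
    (rect_entropy X d f g e N 1 / ln e^-1 / N%:R)%:E.
  have l0 : 0 < ln e^-1 by rewrite ln_gt0// invf_gt1.
  rewrite /dimM dyn_rect (lne_rect_cover sys)// div1r !inver !ifF ?gt_eqF ?ltr0n//.
apply: (@le_trans _ _ (dimM X (dyn_dist f d N) e / N%:R%:E)%E).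
  rewrite E EFinM inver ifF ?gt_eqF ?ltr0n//; apply: lee_wpmul2r.
    by rewrite lee_fin invr_ge0.
  rewrite dyn_rect; have [cov _] := mincoverP (rect_coverable sys e0 N 1).
  exact: dimH_le_dimM e0 e1 cov (rect_cover_gt0 sys e0 N 1).
have : fine (dimM X (dyn_dist f d N) e / N%:R%:E)%E <=
    orbit_rate X d f g e / ln e^-1 + eta.
  by near: N; apply: lim; rewrite ltrDl.
by rewrite E /= -EFinD lee_fin.
Unshelve. all: by end_near.
Qed.

Let h c := density (rect_entropy X d f g c) / ln a.

Let lowH_ge c t : 0 < c -> 0 < t ->
  \forall e \near (0 : R)^'+, ((h c / (1 + t))%:E <= lowH e)%E.
Proof.
move=> cp t0; near=> e.
have e0 : 0 < e by near: e; exact: nbhs_right_gt.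
have ec : e <= c by near: e; exact: nbhs_right_ltW.
have et : e <= expR ((1 + t) * ln c / t).
  by near: e; apply: nbhs_right_ltW; exact: expR_gt0.
have tec : t * ln e <= (1 + t) * ln c.
  by rewrite mulrC -ler_pdivlMr// -[leRHS]expRK ler_ln ?posrE ?expR_gt0.
apply: limf_einf_ge; near=> N.
have N0 : (0 < N)%N by near: N; exists 1%N.
rewrite dyn_rect inver ifF ?gt_eqF ?ltr0n//.
apply: (@le_trans _ _ ((h c / (1 + t) * N%:R)%:E * N%:R^-1%:E)%E).
  by rewrite -EFinM mulfK// pnatr_eq0 -lt0n.
apply: lee_wpmul2r; first by rewrite lee_fin invr_ge0.
apply: le_trans (dimH_ge sys cp ec t0 tec N0); rewrite lee_fin /h.
by rewrite le_eqVlt; apply/orP; left; apply/eqP; field; rewrite !gt_eqF//; lra.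
Unshelve. all: by end_near.
Qed.

Let h_ge0 c : 0 < c -> 0 <= h c.
Proof. by move=> cp; rewrite divr_ge0 ?(ltW lna0)// (density_ge0 (rect_entropy_bisub sys cp)). Qed.

(** Expansiveness passes to smaller scales, so for every [c] up to [c0] all the dimensions are
    caught within [eta] of the same number [h c]. *)
Let chain c : 0 < c -> c <= c0 -> forall eta, 0 < eta ->
  \forall e \near (0 : R)^'+,
    [/\ ((h c - eta)%:E <= lowH e)%E, (lowH e <= upH e)%E,
        (upH e <= mdimM_scale X f d e)%E & (mdimM_scale X f d e <= (h c + eta)%:E)%E].
Proof.
move=> cp cc eta eta0; have hc0 := h_ge0 cp.
have ex e : 0 < e -> e < 1 -> exists L k : nat,
  k%:R <= ln e^-1 / ln a + C /\
  forall N x y, drect d f g (N + L) k x y < c -> drect d f g N 1 x y <= e / 2.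
  move=> e0 e1; have [L [k [kC hk]]] := expand e0 e1.
  by exists L, k; split=> // N x y lt; apply: hk; apply: lt_le_trans cc.
(* Then h / (1 + t) >= h - t h >= h - eta; adding 1 keeps the denominator positive when [h c] is
   0. *)
pose t := eta / (h c + 1).
have t0 : 0 < t by rewrite divr_gt0//; lra.
have ht : h c - eta <= h c / (1 + t).
  have ht : t * h c <= eta by rewrite /t mulrAC ler_pdivrMr; nra.
  rewrite ler_pdivlMr; last by lra.
  by nra.
have up := mdimM_upper sys cp ex eta0.
near=> e.
have e0 : 0 < e by near: e; exact: nbhs_right_gt.
have e1 : e < 1 by near: e; exact: nbhs_right_lt.
split; [|exact: lowH_le_upH|exact: upH_le|].
- apply: (@le_trans _ _ (h c / (1 + t))%:E); first by rewrite lee_fin.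
  by near: e; exact: lowH_ge.
- rewrite (mdimM_scaleE sys)// lee_fin.
  by near: e; exact: up.
Unshelve. all: by end_near.
Qed.

Lemma mean_dimensions_eq_entropy :
  [/\ lower_mdimH X f d = upper_mdimH X f d,
      lower_mdimM X f d = upper_mdimM X f d,
      upper_mdimH X f d = (htop2 X f g d / (ln a)%:E)%E
    & upper_mdimM X f d = (htop2 X f g d / (ln a)%:E)%E].
Proof.
have lowE c : 0 < c -> c <= c0 -> lower_mdimH X f d = (h c)%:E.
  move=> cp cc; apply/cvg_lim => //; apply: cvg_ereal_squeeze => eta /(chain cp cc).
  by apply: filterS => e [l1 l2 l3 l4]; split=> //; apply: le_trans l2 (le_trans l3 l4).
have upE c : 0 < c -> c <= c0 -> upper_mdimH X f d = (h c)%:E.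
  move=> cp cc; apply/cvg_lim => //; apply: cvg_ereal_squeeze => eta /(chain cp cc).
  by apply: filterS => e [l1 l2 l3 l4]; split; [exact: le_trans l1 l2|exact: le_trans l3 l4].
have [MlE MuE] : lower_mdimM X f d = (h c0)%:E /\ upper_mdimM X f d = (h c0)%:E.
  apply: limf_esup_einf_squeeze => eta /(chain c0_gt0 (lexx _)).
  by apply: filterS => e [l1 l2 l3 l4]; split=> //; apply: le_trans l1 (le_trans l2 l3).
(* The lower mean Hausdorff dimension does not depend on [c], hence neither does [h c], and the
   limit in [htop2] is that of an eventually constant function. *)
have hE c : 0 < c -> c <= c0 -> h c = h c0.
  by move=> cp cc; apply: EFin_inj; rewrite -(lowE c)// (lowE c0).
have topE : htop2 X f g d = (h c0 * ln a)%:E.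
  apply/cvg_lim => //; apply: cvg_near_cst; near=> c.
  have cp : 0 < c by near: c; exact: nbhs_right_gt.
  have cc : c <= c0 by near: c; exact: nbhs_right_ltW.
  rewrite -(hE c)// /h divfK ?gt_eqF//; apply/cvg_lim => //; exact: (htop_scaleE sys cp).
have -> : (htop2 X f g d / (ln a)%:E)%E = (h c0)%:E.
  by rewrite topE inver ifF ?gt_eqF// -EFinM mulfK ?gt_eqF.
by rewrite (lowE c0)// (upE c0)// MlE MuE.
Unshelve. all: by end_near.
Qed.

End mean_dimensions.

(** * The circle *)

Section circle_metric.
Variable R : realType.
Local Open Scope quotient_scope.
Implicit Types (t s x y : R) (u v w : circle R).

Definition int_dist t : R := inf [set `|t - k%:~R| | k in [set: int]].

Lemma int_dist_attained t : exists2 k : int, int_dist t = `|t - k%:~R|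
  & forall j : int, int_dist t <= `|t - j%:~R|.
Proof.
have lb (j : int) : int_dist t <= `|t - j%:~R|.
  by apply: ge_inf; [exists 0 => _ [i _ <-]|exists j].
have [k kmin] := dist_int_min t; exists k => //.
apply/eqP; rewrite eq_le lb; apply: lb_le_inf; first by eexists; exists k.
by move=> _ [j _ <-].
Qed.

Lemma int_dist_ge0 t : 0 <= int_dist t.
Proof. by have [k -> _] := int_dist_attained t. Qed.

Lemma int_dist_le_norm t : int_dist t <= `|t|.
Proof. by have [_ _ /(_ 0)] := int_dist_attained t; rewrite subr0. Qed.

Lemma int_distN t : int_dist (- t) = int_dist t.
Proof.
suff le s : int_dist (- s) <= int_dist s.
  by apply/eqP; rewrite eq_le le -{1}(opprK t) le.
have [k -> _] := int_dist_attained s; have [_ _ /(_ (- k))] := int_dist_attained (- s).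
by rewrite rmorphN -normrN opprD !opprK.
Qed.

Lemma int_distD t s : int_dist (t + s) <= int_dist t + int_dist s.
Proof.
have [k -> _] := int_dist_attained t; have [j -> _] := int_dist_attained s.
have [_ _ /(_ (k + j))/le_trans] := int_dist_attained (t + s); apply.
by rewrite rmorphD opprD addrACA ler_normD.
Qed.

Lemma int_dist_half t : int_dist t <= 2^-1.
Proof.
have [_ _ /(_ (Num.floor (t + 2^-1)))/le_trans] := int_dist_attained t; apply.
have := floor_itv (t + 2^-1); rewrite intrD => /andP[kt tk].
by rewrite ler_norml; apply/andP; split; lra.
Qed.

(** Every nonzero integer is at distance at least 1 - |t| >= 1/2 from [t], so 0 is a nearest
    integer. *)
Lemma int_dist_small t : `|t| <= 2^-1 -> int_dist t = `|t|.
Proof.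
move=> t2; apply/eqP; rewrite eq_le int_dist_le_norm /=.
have [k -> _] := int_dist_attained t.
have [->|k0] := eqVneq k 0; first by rewrite subr0.
have k1 : 1 <= `|k%:~R| :> R.
  by rewrite -intr_norm ler1z -gtz0_ge1 normr_gt0.
by have := ler_normB (k%:~R - t) (- t); rewrite opprK subrK normrN distrC; lra.
Qed.

Lemma circle_distE x y : circle_dist (\pi_(circle R) x) (\pi_(circle R) y) = int_dist (x - y).
Proof. exact: circle_dist_pi. Qed.

Lemma circle_dist_refl u : circle_dist u u = 0.
Proof.
rewrite -(reprK u) circle_distE subrr; apply/eqP.
by rewrite eq_le int_dist_ge0 andbT (le_trans (int_dist_le_norm _))// normr0.
Qed.

Lemma circle_dist_ge0 u v : 0 <= circle_dist u v.
Proof. exact: int_dist_ge0. Qed.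

Lemma circle_dist_sym u v : circle_dist u v = circle_dist v u.
Proof. by rewrite /circle_dist -!/(int_dist _) -int_distN opprB. Qed.

Lemma circle_dist_tri u v w : circle_dist u w <= circle_dist u v + circle_dist v w.
Proof.
rewrite /circle_dist -!/(int_dist _); apply: le_trans (int_distD _ _).
by rewrite addrA subrK.
Qed.

Lemma circle_dist_half u v : circle_dist u v <= 2^-1.
Proof. exact: int_dist_half. Qed.

Lemma circle_distMn u v n : circle_dist (u *+ n) (v *+ n) <= n%:R * circle_dist u v.
Proof.
rewrite -(reprK u) -(reprK v) -!raddfMn !circle_distE -mulrnBl.
elim: n => [|n IH]; first by rewrite mulr0n mul0r (le_trans (int_dist_le_norm _))// normr0.
rewrite mulrS -natr1 mulrDl mul1r addrC; apply: le_trans (int_distD _ _) _.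
by rewrite lerD2r.
Qed.

(* Multiplication by n is exactly n-expanding below scale 1/(2n). *)
Lemma circle_distMn_small u v n : n%:R * circle_dist u v <= 2^-1 ->
  circle_dist (u *+ n) (v *+ n) = n%:R * circle_dist u v.
Proof.
have [k Ek _] := int_dist_attained (repr u - repr v).
(* The representative of [v] is moved so that the real difference attains the circle distance. *)
have Ev : v = \pi_(circle R) (repr v + k%:~R).
  rewrite -{1}(reprK v); apply/eqP; rewrite -Quotient.idealrBE opprD addrA subrr add0r.
  by rewrite rpredN integersE intr_int.
rewrite -(reprK u) Ev -!raddfMn !circle_distE -mulrnBl.
have -> : int_dist (repr u - (repr v + k%:~R)) = `|repr u - (repr v + k%:~R)|.
  by rewrite -circle_distE -Ev reprK -[circle_dist _ _]/(int_dist _) Ek opprD addrA.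
by rewrite mulr_natl -normrMn => h; rewrite int_dist_small.
Qed.

End circle_metric.

(** * Sequences in the circle *)

Section seq_metric.
Variable R : realType.
Local Notation seqs := (circle_seq R).
Local Notation sd := (@seq_dist R).
Local Notation shift := (@seq_shift R).
Local Notation mul := (@seq_mul R).
Implicit Types x y z : seqs.

Let term x y (n : nat) : R := 2 ^- n.+1 * circle_dist (x n) (y n).

Let pow2_gt0 n : 0 < 2 ^- n :> R.
Proof. by rewrite invr_gt0 exprn_gt0. Qed.

Let term_ge0 x y n : 0 <= term x y n.
Proof. by rewrite mulr_ge0 ?circle_dist_ge0 ?(ltW (pow2_gt0 _)). Qed.

Let series_term_le1 x y n : series (term x y) n <= 1.
Proof.
have : series (term x y) n <= 1 - 2 ^- n; last by have := pow2_gt0 n; lra.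
elim: n => [|n IH]; first by rewrite /series/= big_geq// expr0 invr1 subrr.
have : series (term x y) n.+1 - series (term x y) n = 2 ^- n.+1 * circle_dist (x n) (y n).
  exact: seriesSB.
have h : 2 ^- n.+1 * circle_dist (x n) (y n) <= 2 ^- n.+1 * 1.
  by rewrite ler_pM2l//; apply: le_trans (circle_dist_half _ _) _; lra.
have E : 2 ^- n = 2 * 2 ^- n.+1 :> R by rewrite exprS invfM mulrA divff ?mul1r.
by move: IH h; rewrite E; move: (2 ^- n.+1) (series _ n) (series _ n.+1) => *; lra.
Qed.

Let cvg_term x y : cvgn (series (term x y)).
Proof.
apply: nondecreasing_is_cvgn.
  apply/nondecreasing_seqP => n; rewrite -subr_ge0 seriesSB; exact: term_ge0.
by exists 1 => _ [n _ <-]; exact: series_term_le1.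
Qed.

(** Splitting off the first coordinate; the estimates for that coordinate, for the shift and for the
    tail follow from this identity without the series. *)
Lemma seq_dist_rec x y :
  sd x y = 2^-1 * circle_dist (x 0%N) (y 0%N) + 2^-1 * sd (shift x) (shift y).
Proof.
rewrite /seq_dist; apply/cvg_lim => //; rewrite -cvg_shiftS.
have -> : [sequence series (term x y) n.+1]_n = (fun n =>
    2^-1 * circle_dist (x 0%N) (y 0%N) + 2^-1 * series (term (shift x) (shift y)) n).
  apply/funext => n; rewrite /series/= big_nat_recl// /term expr1; congr (_ + _).
  by rewrite mulr_sumr; apply: eq_bigr => i _; rewrite mulrA -invfM -exprS.
apply: cvgD; first exact: cvg_cst.
apply: cvgM; [exact: cvg_cst|exact: cvg_term].
Qed.

Lemma seq_dist_ge0 x y : 0 <= sd x y.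
Proof.
apply: limr_ge; first exact: cvg_term.
by apply: nearW => n; apply: sumr_ge0 => i _; exact: term_ge0.
Qed.

Lemma seq_dist_le1 x y : sd x y <= 1.
Proof.
apply: limr_le; first exact: cvg_term.
by apply: nearW => n; exact: series_term_le1.
Qed.

Lemma seq_dist_pseudometric : is_pseudometric sd.
Proof.
split=> [x|x y|x y z].
- apply/cvg_lim => //; apply: cvg_near_cst; apply: nearW => n.
  by rewrite /series/= big1// => i _; rewrite circle_dist_refl mulr0.
- rewrite /seq_dist; congr (limn (series _)).
  by apply/funext => n; rewrite circle_dist_sym.
- rewrite /seq_dist -!/(term _ _) -lim_seriesD; [|exact: cvg_term..].
  apply: lim_series_le; [exact: cvg_term| |].
    by apply: is_cvg_seriesD; exact: cvg_term.
  move=> n; rewrite -[leRHS]/(term x y n + term y z n) /term -mulrDr.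
  by rewrite ler_pM2l// circle_dist_tri.
Qed.

Lemma circle_dist_head x y : circle_dist (x 0%N) (y 0%N) <= 2 * sd x y.
Proof. by rewrite [X in _ <= 2 * X]seq_dist_rec; have := seq_dist_ge0 (shift x) (shift y); lra. Qed.

Lemma seq_dist_shift x y : sd (shift x) (shift y) <= 2 * sd x y.
Proof.
by rewrite [X in _ <= 2 * X]seq_dist_rec; have := circle_dist_ge0 (x 0%N) (y 0%N); lra.
Qed.

Lemma seq_dist_mul a x y : sd (mul a x) (mul a y) <= a%:R * sd x y.
Proof.
rewrite -[leRHS]/(a%:R *: sd x y) /seq_dist -!/(term _ _) -lim_seriesZ; last exact: cvg_term.
apply: lim_series_le; [exact: cvg_term|apply: is_cvg_seriesZ; exact: cvg_term|].
move=> n; rewrite -[leRHS]/(a%:R * term x y n) /term mulrCA.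
by rewrite ler_pM2l// circle_distMn.
Qed.

(** The first [L] coordinates carry total weight at most 1, the remaining ones 2^-L. *)
Lemma seq_dist_tail L (c : R) x y : 0 <= c ->
  (forall i, (i < L)%N -> circle_dist (x i) (y i) <= c) -> sd x y <= c + 2 ^- L.
Proof.
move=> c0; elim: L x y => [|L IH] x y h.
  by rewrite expr0 invr1; have := seq_dist_le1 x y; lra.
have h1 : circle_dist (x 0%N) (y 0%N) <= c by exact: h.
have h2 := IH (shift x) (shift y) (fun i iL => h i.+1 iL).
have E : 2 ^- L = 2 * 2 ^- L.+1 :> R by rewrite exprS invfM mulrA divff ?mul1r.
by rewrite seq_dist_rec; move: h2; rewrite E; move: (2 ^- L.+1) => *; lra.
Qed.

Lemma iter_shiftE i x n : iter i shift x n = x (n + i)%N.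
Proof. by elim: i n => [|i IH] n; rewrite ?addn0//= /seq_shift IH addSnnS. Qed.

Lemma iter_mulE a j x n : iter j (mul a) x n = x n *+ a ^ j.
Proof. by elim: j => [|j IH]; rewrite ?expn0//= /seq_mul IH -mulrnA expnSr. Qed.

Lemma exists_half_pow_lt (r : R) : 0 < r -> exists L, 2 ^- L < r.
Proof.
move=> r0; exists (Num.trunc r^-1).+1.
have ri : 0 < r^-1 by rewrite invr_gt0.
have /andP[_ h] := truncn_itv (ltW ri).
rewrite -[ltRHS]invrK ltf_pV2 ?posrE ?exprn_gt0//; apply: lt_trans h _.
by rewrite -natrX ltr_nat ltn_expl.
Qed.

(** * Expansiveness of the shift together with multiplication by [a] *)

Section expansion.
Variable a : nat.
Hypothesis a_gt1 : (1 < a)%N.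
Let a1 : 1 < a%:R :> R. Proof. by rewrite ltr1n. Qed.
Let a0 : 0 < a%:R :> R. Proof. by rewrite ltr0n ltnW. Qed.

(** Iterates of the shift bring coordinate [i] to the front, where its weight is 1/2. *)
Lemma drect_circle_dist N k x y i j (c : R) : 0 < c ->
  drect sd shift (mul a) N k x y < c -> (i < N)%N -> (j < k)%N ->
  circle_dist (x i *+ a ^ j) (y i *+ a ^ j) < 2 * c.
Proof.
move=> c0 hc iN jk; have := drect_ub sd shift (mul a) x y iN jk.
have := circle_dist_head (iter i shift (iter j (mul a) x)) (iter i shift (iter j (mul a) y)).
by rewrite !iter_shiftE !iter_mulE add0n; lra.
Qed.

(** As long as [a] times the current distance is at most 1/2, the next multiplication is exactly
    [a]-expanding, so the original distance was smaller by the full power of [a]. *)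
Lemma circle_dist_expansion (u v : circle R) k :
  (forall j, (j < k)%N -> a%:R * circle_dist (u *+ a ^ j) (v *+ a ^ j) <= 2^-1) ->
  (0 < k)%N -> a%:R ^+ k * circle_dist u v <= 2^-1.
Proof.
move=> h k0; have E j : (j < k)%N ->
    circle_dist (u *+ a ^ j) (v *+ a ^ j) = a%:R ^+ j * circle_dist u v.
  elim: j => [|j IH] jk; first by rewrite mul1r.
  rewrite expnSr !mulrnA circle_distMn_small ?h ?(ltnW jk)//.
  by rewrite IH ?(ltnW jk)// mulrA exprS.
have kk : (k.-1 < k)%N by rewrite prednK.
by have := h _ kk; rewrite E// mulrA -exprS prednK.
Qed.

(** The scale 1/(4a) puts coordinates within 1/(2a) of each other, which is the range of exact
    expansion by [a]. *)
Lemma seq_expansive (e : R) : 0 < e -> e < 1 -> exists L k : nat,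
  k%:R <= ln e^-1 / ln a%:R + (ln 2 / ln a%:R + 1) /\
  forall N x y, drect sd shift (mul a) (N + L) k x y < (4 * a%:R)^-1 ->
    drect sd shift (mul a) N 1 x y <= e / 2.
Proof.
move=> e0 e1; have lna : 0 < ln a%:R :> R by exact: ln_gt0.
have [L hL] := @exists_half_pow_lt (e / 4) ltac:(lra).
have e2 : 1 <= 2 / e by rewrite ler_pdivlMr//; lra.
(* With k = k' + 1, a^k > 2/e turns a^k dist <= 1/2 into dist <= e/4, the other e/4 being left to
   the tail; a^k' <= 2/e bounds k. *)
have [k' /andP[k1 k2]] := exists_pow_floor a1 e2.
exists L, k'.+1; split.
  rewrite -natr1 addrA lerD2r -mulrDl ler_pdivlMr// mulr_natl -lnXn//.
  by rewrite -lnM ?posrE ?invr_gt0// mulrC ler_ln ?posrE ?exprn_gt0// divr_gt0.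
move=> N x y hxy; apply/drect_leP; first by lra.
move=> m [|//] mN _; rewrite /=.
suff : sd (iter m shift x) (iter m shift y) <= e / 4 + 2 ^- L by lra.
apply: seq_dist_tail => [|i iL]; first by lra.
rewrite !iter_shiftE.
have c0 : 0 < (4 * a%:R)^-1 :> R by rewrite invr_gt0 mulr_gt0.
have iN : (i + m < N + L)%N by rewrite addnC -addSn leq_add// ltnW.
have := @circle_dist_expansion (x (i + m)%N) (y (i + m)%N) k'.+1 _ isT.
have le j : (j < k'.+1)%N ->
    a%:R * circle_dist (x (i + m)%N *+ a ^ j) (y (i + m)%N *+ a ^ j) <= 2^-1.
  move=> jk; have := drect_circle_dist c0 hxy iN jk => /ltW.
  rewrite -(ler_pM2l a0) => /le_trans; apply.
  by rewrite le_eqVlt; apply/orP; left; apply/eqP; field; rewrite gt_eqF.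
move=> /(_ le); rewrite mulrC -ler_pdivlMr ?exprn_gt0// => /le_trans; apply.
rewrite ler_pdivrMr ?exprn_gt0//; move: k2; rewrite ltr_pdivrMr//; lra.
Qed.

End expansion.

End seq_metric.

(** * Compactness *)

HB.instance Definition _ (R : realType) := isPointed.Build (circle R) 0.
HB.instance Definition _ (R : realType) := isPointed.Build (circle_seq R) (fun=> 0).

Lemma relatively_compact_of_compact (R : realType) (T : ptopologicalType)
    (d : T -> T -> R) (X : set T) : compact X ->
  (forall x r, 0 < r -> nbhs x [set y | d x y < r]) -> relatively_compact X d.
Proof.
rewrite compact_cover => cX ball_nbhs U oU XU.
(* An open set of the whole space whose trace on [X] lies in [U t]. *)
pose V t := [set y | X y -> U t y]^°.
have [||D _ XD] := cX T setT V; first by move=> t _; exact: open_interior.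
  move=> x Xx; have [t _ Ux] := XU x Xx; exists t => //.
  have [r r0 hr] := (oU t).2 x Ux.
  by apply: filterS (ball_nbhs x r r0) => y xy Xy; exact: hr.
pose s : seq T := finmap.enum_fset D; exists (size s), (fun i => tnth (in_tuple s) i) => x Xx.
have [t /= tD Vtx] := XD x Xx.
have ts : (index t s < size s)%N by rewrite index_mem.
exists (Ordinal ts) => //; rewrite (tnth_nth t) /= nth_index//.
exact: (interior_subset Vtx).
Qed.

Section circle_seq_compact.
Variable R : realType.
Local Open Scope quotient_scope.

Lemma circle_ball_open (u : circle R) r : open [set v | circle_dist u v < r].
Proof.
rewrite -[open _]/(open (\pi_(circle R) @^-1` [set v | circle_dist u v < r])).
have E x : circle_dist u (\pi_(circle R) x) = int_dist (repr u - x).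
  by rewrite -circle_distE reprK.
rewrite openE => x /=; rewrite E => xr.
have r0 : 0 < r - int_dist (repr u - x) by rewrite subr_gt0.
apply/nbhs_ballP; exists (r - int_dist (repr u - x)) => //= y; rewrite /ball/= E => xy.
have := int_distD (repr u - x) (x - y); rewrite addrA subrK => /le_lt_trans; apply.
by have := int_dist_le_norm (x - y); lra.
Qed.

Lemma circle_compact : compact [set: circle R].
Proof.
have cont : continuous (\pi_(circle R)).
  by apply/continuousP => A oA; exact: oA.
have -> : [set: circle R] = \pi_(circle R) @` `[0, 1].
  apply/seteqP; split=> // u _; exists (repr u - (Num.floor (repr u))%:~R).
    have := floor_itv (repr u); rewrite intrD => /andP[h1 h2].
    by rewrite /= in_itv/=; apply/andP; split; lra.
  rewrite -[RHS]reprK; apply/eqP; rewrite -Quotient.idealrBE addrAC subrr add0r.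
  by rewrite rpredN integersE intr_int.
apply: continuous_compact; last exact: segment_compact.
exact: continuous_subspaceT.
Qed.

(** Up to a tail of size 2^-L the distance depends on [L] coordinates only, so the ball contains a
    basic neighbourhood of the product topology. *)
Lemma seq_ball_nbhs (x : circle_seq R) r : 0 < r ->
  nbhs x [set y | seq_dist x y < r].
Proof.
move=> r0; have [L hL] := @exists_half_pow_lt R (r / 2) ltac:(lra).
have h : \forall y \near x, forall i : 'I_L, circle_dist (x i) ((y : circle_seq R) i) < r / 2.
  apply: (@filter_forall _ 'I_L
    (fun i => [set y : circle_seq R | circle_dist (x i) (y i) < r / 2]) (nbhs x)).
  move=> i.
  have := @proj_continuous nat (fun=> circle R) (i : nat) x
    [set v | circle_dist (x i) v < r / 2]; apply.
  apply: open_nbhs_nbhs; split; first exact: circle_ball_open.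
  by rewrite /= circle_dist_refl; lra.
apply: filterS h => y h /=; apply: (@le_lt_trans _ _ (r / 2 + 2 ^- L)); last by lra.
apply: seq_dist_tail => [|i iL]; first by lra.
exact: ltW (h (Ordinal iL)).
Qed.

Lemma circle_seq_compact (X : set (circle_seq R)) : closed X -> compact X.
Proof.
move=> cX; apply: (subclosed_compact cX) (@subsetT _ X).
have := @tychonoff nat (fun=> circle R) (fun=> setT) (fun=> circle_compact).
by rewrite (_ : [set f | _] = setT)//; apply/seteqP; split.
Qed.

End circle_seq_compact.

Lemma shift_mul_system (R : realType) (a : nat) (X : set (circle_seq R)) :
  (1 < a)%N -> X !=set0 -> closed X ->
  @seq_shift R @` X `<=` X -> @seq_mul R a @` X `<=` X ->
  commuting_system X (@seq_dist R) (@seq_shift R) (@seq_mul R a) 2 a%:R.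
Proof.
move=> a_gt1 X_neq0 X_closed X_shift X_times; split => //.
- exact: seq_dist_pseudometric.
- apply: relatively_compact_of_compact; first exact: circle_seq_compact.
  exact: seq_ball_nbhs.
- by move=> x Xx; apply: X_shift; exists x.
- by move=> x Xx; apply: X_times; exists x.
- by rewrite ltr1n.
- exact: seq_dist_shift.
- exact: seq_dist_mul.
Qed.

Local Open Scope ereal_scope.

Theorem theorem3p1 (R : realType) (a : nat) (X : set (circle_seq R))
    (a_gt1 : (1 < a)%N) (X_neq0 : X !=set0) (X_closed : closed X)
    (X_shift : @seq_shift R @` X `<=` X) (X_times : @seq_mul R a @` X `<=` X) :
  [/\ lower_mdimH X (@seq_shift R) (@seq_dist R) = upper_mdimH X (@seq_shift R) (@seq_dist R),
      lower_mdimM X (@seq_shift R) (@seq_dist R) = upper_mdimM X (@seq_shift R) (@seq_dist R),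
      upper_mdimH X (@seq_shift R) (@seq_dist R) =
        htop2 X (@seq_shift R) (@seq_mul R a) (@seq_dist R) / (ln a%:R)%:E
    & upper_mdimM X (@seq_shift R) (@seq_dist R) =
        htop2 X (@seq_shift R) (@seq_mul R a) (@seq_dist R) / (ln a%:R)%:E].
Proof.
have c0_gt0 : (0 < (4 * a%:R)^-1 :> R)%R by rewrite invr_gt0 mulr_gt0// ltr0n ltnW.
exact: mean_dimensions_eq_entropy
  (shift_mul_system a_gt1 X_neq0 X_closed X_shift X_times) c0_gt0 (seq_expansive a_gt1).
Qed.
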